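(* Let $\lambda>0$ and $R=\frac{2}{\lambda}$. For every $\hat r\in\left(R,\frac{\sqrt7}{2}R\right)$ and every $\epsilon\in\left(0,1-\frac{1}{\sqrt2}\right)$ there exists $\delta=\delta(R,\hat r,\epsilon)>0$ such that the following holds. Let $\Omega\subset\mathbb{R}^2$ be bounded and measurable, let $\Sigma$ be any minimizer of $E(\Sigma)=\mathrm{Per}(\Sigma)+\lambda|\Sigma\vartriangle\Omega|$ over measurable subsets of $\mathbb{R}^2$, and let $B_{\hat r}$ and $B_{(1-\epsilon)R}$ be concentric balls in $\mathbb{R}^2$ of radii $\hat r$ and $(1-\epsilon)R$. If $|B_{\hat r}\setminus\Omega|<\delta$, then $B_{(1-\epsilon)R}\subset\Sigma$ up to a Lebesgue null set, i.e. $|B_{(1-\epsilon)R}\setminus\Sigma|=0$.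
   Context: For a Lebesgue measurable set $\Sigma\subset\mathbb{R}^2$, $\mathrm{Per}(\Sigma)=\int|\nabla\chi_\Sigma|\,dx\in[0,\infty]$ is the perimeter of $\Sigma$ in $\mathbb{R}^2$ (the total variation of its characteristic function). $|\cdot|$ denotes Lebesgue measure and $\vartriangle$ is symmetric difference. A minimizer of $E$ is a measurable set $\Sigma$ with $E(\Sigma)\le E(\Sigma')$ for all measurable $\Sigma'\subset\mathbb{R}^2$. The number $\delta$ does not depend on $\Omega$, $\Sigma$ or the center of the balls. *)

(* Defs.v *)
From HB Require Import structures.
From mathcomp Require Import all_boot all_order all_algebra.
From mathcomp Require Import all_classical all_reals all_analysis.

Set Implicit Arguments.
Unset Strict Implicit.
Unset Printing Implicit Defensive.
Import Order.TTheory GRing.Theory Num.Theory.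
Import numFieldNormedType.Exports.
Local Open Scope classical_set_scope.
Local Open Scope ring_scope.

Definition borel_measure2 (R : realType) :
    {measure set (measurableTypeR R * measurableTypeR R) -> \bar R} :=
  (lebesgue_measure \x lebesgue_measure)%E.

(* A copy of R * R whose measurable sets are the Lebesgue measurable subsets
   of the plane: the planar analogue of completed_lebesgue_measure. *)
Definition lebesgue_plane (R : realType) : measurableType _ :=
  caratheodory_type ((borel_measure2 R)^*)%mu.

Definition lebesgue_measure2 (R : realType) :
    {measure set (lebesgue_plane R) -> \bar R} :=
  @completed_measure_extension _ _ _ (borel_measure2 R).

Definition lebesgue_measurable2 (R : realType) (A : set (R * R)) : Prop :=
  @measurable _ (lebesgue_plane R) A.

(* The norm carried by the product type R * R is the sup norm, hence this. *)
Definition euclid_norm (R : realType) (x : R * R) : R :=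
  Num.sqrt (x.1 ^+ 2 + x.2 ^+ 2).

Definition euclid_ball (R : realType) (c : R * R) (r : R) : set (R * R) :=
  [set x | euclid_norm (x - c) < r].

Definition C1_compact_support (R : realType) (phi : R * R -> R * R) : Prop :=
  [/\ forall x, differentiable phi x,
      forall v, continuous ('D_v phi) &
      compact (closure [set x | phi x != 0])].

Definition divergence (R : realType) (phi : R * R -> R * R) (x : R * R) : R :=
  'D_(1, 0) (fst \o phi) x + 'D_(0, 1) (snd \o phi) x.

Definition total_variation2 (R : realType) (f : R * R -> R) : \bar R :=
  ereal_sup [set v | exists phi : R * R -> R * R,
    [/\ C1_compact_support phi,
        forall x, euclid_norm (phi x) <= 1 &
        v = (\int[lebesgue_measure2 R]_x (f x * divergence phi x)%:E)%E]].

Definition perimeter (R : realType) (S : set (R * R)) : \bar R :=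
  total_variation2 (\1_S : R * R -> R).

Definition energy (R : realType) (lambda : R) (Omega S : set (R * R)) :
    \bar R :=
  (perimeter S + lambda%:E * lebesgue_measure2 R (S `+` Omega))%E.

Definition is_minimizer (R : realType) (lambda : R) (Omega S : set (R * R)) :
    Prop :=
  lebesgue_measurable2 S /\
  forall S' : set (R * R), lebesgue_measurable2 S' ->
    (energy lambda Omega S <= energy lambda Omega S')%E.

(* Main.v *)
Require Import Defs.
From HB Require Import structures.
From mathcomp Require Import all_boot all_order all_algebra.
From mathcomp Require Import all_classical all_reals all_analysis.
From mathcomp Require Import measurable_realfun ring lra.

Set Implicit Arguments.
Unset Strict Implicit.
Unset Printing Implicit Defensive.
Import Order.TTheory GRing.Theory Num.Theory.
Import numFieldNormedType.Exports.
Local Open Scope classical_set_scope.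
Local Open Scope ring_scope.

(* Compare a minimizer S with S `|` B_t. For a cutoff chi between B_a and B_b,
   a <= t <= b, and test fields phi, psi, the field (1 - chi) phi + chi psi is again
   a test field, and testing S against it bounds the flux of phi through S `|` B_t
   by Per S plus terms supported in B_b `\` S. A bisection finds t for which the
   annulus terms stay under control as b - a tends to 0.
   - With psi = (x - c) / t this gives Per (S `|` B_t) <= Per S + (2 / t) V(t),
     where V(t) = |B_t `\` S|. By minimality
     (lambda - 2 / t) V(t) <= 2 lambda |B_t `\` Omega|, so V is small at a radius
     slightly larger than 2 / lambda.
   - With psi an arbitrary test field this gives
     Per (S `|` B_t) + Per (B_t `\` S) <= Per S + 16 V(b) / (b - a), so by
     minimality Per (B_t `\` S) <= 18 V(b) / (b - a) as soon as
     lambda (b - a) <= 2, and an isoperimetric inequality with a crude constant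
     yields V(a) <= C (V(b) / (b - a)) ^ 2. De Giorgi's iteration then shows that V
     vanishes at radius (1 - eps) R0. *)

(** Everything is expressed by fluxes of test fields; neither traces nor the reduced boundary of [S]
    appear. Two points shape the argument. First, [t] has to be fixed before the test fields, since
    the perimeter of the filled set is a supremum over them, whereas the annulus errors involve sup
    norms of their divergences. Hence one [t] surrounded by arbitrarily thin good annuli, and a
    limit taken for each field separately. Bisection supplies it without differentiating the area.
    Second, the annulus errors must be measured outside [S]: a compactly supported field has
    opposite fluxes through [S] and through its complement, so the part of the field changed by the
    cutoff is always estimated in the complement. The two choices of [psi] complement each other.
    The first has divergence [2 / t], which [lambda] beats exactly beyond the radius [2 / lambda];
    there the defect of [Omega] still leaves [V] small rather than zero. Below that radius the
    linear bound says nothing, and it is the superlinear decay that turns small into zero. *)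

Lemma bisection_slope (R : realType) (f : R -> R) (a b q : R) :
  a < b -> f b - f a <= (b - a) * q ->
  exists t, a <= t <= b /\ forall e, 0 < e -> exists u v,
    [/\ a <= u, u <= t, t <= v & v <= b] /\
    [/\ u < v, v - u < e & f v - f u <= (v - u) * q].
Proof.
move=> ab fab.
pose good (I : R * R) := I.1 < I.2 /\ f I.2 - f I.1 <= (I.2 - I.1) * q.
pose mid (I : R * R) : R := (I.1 + I.2) / 2.
(* The mean slope of an interval is the average of those of its halves, so one half keeps a slope of
   at most [q]. *)
pose step (I : R * R) : R * R :=
  if f (mid I) - f I.1 <= (mid I - I.1) * q then (I.1, mid I) else (mid I, I.2).
have step_good I : good I -> [/\ good (step I), I.1 <= (step I).1, (step I).2 <= I.2
    & (step I).2 - (step I).1 = (I.2 - I.1) / 2].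
  case: I => u v [/= uv fuv]; rewrite /step /good /mid/=.
  by case: ifPn => [h|]; rewrite -?ltNge /= => *; split => //=; try split; lra.
pose I n := iter n step (a, b).
have I_good n : good (I n) by elim: n => [|n /step_good[]].
have I1S n : (I n).1 <= (I n.+1).1 by have [] := step_good _ (I_good n).
have I2S n : (I n.+1).2 <= (I n).2 by have [] := step_good _ (I_good n).
have Ilen n : (I n).2 - (I n).1 = (b - a) / 2 ^+ n.
  elim: n => [|n IHn]; first by rewrite expr0 divr1.
  have [_ _ _ ->] := step_good _ (I_good n); rewrite IHn exprSr invfM mulrA; lra.
have I1 m n : (m <= n)%N -> (I m).1 <= (I n).1.
  by move=> /subnK <-; elim: (n - m)%N => // k IHk; apply: le_trans IHk _; exact: I1S.
have I2 m n : (m <= n)%N -> (I n).2 <= (I m).2.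
  by move=> /subnK <-; elim: (n - m)%N => // k IHk; apply: le_trans IHk; exact: I2S.
have I12 m n : (I m).1 <= (I n).2.
  apply: le_trans (I1 _ _ (leq_maxl m n)) _; apply: le_trans (I2 _ _ (leq_maxr m n)).
  by have [/ltW] := I_good (maxn m n).
pose t := sup (range (fun n => (I n).1)).
have tu n : (I n).1 <= t.
  apply: ub_le_sup; last by exists n.
  by exists (I 0).2 => _ [m _ <-]; exact: I12.
have tv n : t <= (I n).2.
  apply: ge_sup; first by exists (I 0).1, 0%N.
  by move=> _ [m _ <-]; exact: I12.
exists t; split; first by rewrite (tu 0%N) (tv 0%N).
(* After [n.+1] halvings the length is below [e], because [2 ^ n.+1 > n.+1 > (b - a) / e]. *)
move=> e e0; pose n := Num.truncn ((b - a) / e).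
have ne : (b - a) / e < n.+1%:R by exact: truncnS_gt.
exists (I n.+1).1, (I n.+1).2; split.
  by split=> //; [exact: (I1 0%N)|exact: (I2 0%N)].
have [lt12 q12] := I_good n.+1; split => //.
rewrite Ilen ltr_pdivrMr ?exprn_gt0//.
move: ne; rewrite ltr_pdivrMr// => /lt_le_trans; apply.
rewrite mulrC ler_pM2l// -natrX ler_nat; apply: ltnW; exact: ltn_expl.
Qed.

(** * C1 functions of the plane *)

Definition C1line (R : realType) (a : R -> R) :=
  (forall x, derivable a x 1) /\ continuous (derive1 a).

(** The C1 condition of [C1_compact_support], for a scalar component and without the support. *)
Definition C1plane (R : realType) (f : R * R -> R) :=
  (forall x, differentiable f x) /\ forall v, continuous ('D_v f).

Section C1.
Context {R : realType}.
Implicit Types (f g : R * R -> R) (a : R -> R) (x v : R * R).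

Lemma C1plane_continuous f : C1plane f -> continuous f.
Proof. by move=> [df _] x; apply: differentiable_continuous. Qed.

Lemma C1plane_derivable f x v : C1plane f -> derivable f x v.
Proof. by move=> [df _]; apply: diff_derivable. Qed.

Lemma C1line_continuous a : C1line a -> continuous a.
Proof.
by move=> [da _] x; apply: differentiable_continuous; apply/derivable1_diffP.
Qed.

Lemma D_add f g v x : C1plane f -> C1plane g ->
  'D_v (fun z => f z + g z) x = 'D_v f x + 'D_v g x.
Proof. by move=> Cf Cg; rewrite -deriveD//; exact: C1plane_derivable. Qed.

Lemma D_mul f g v x : C1plane f -> C1plane g ->
  'D_v (fun z => f z * g z) x = 'D_v f x * g x + f x * 'D_v g x.
Proof.
move=> Cf Cg; rewrite deriveM; [|exact: C1plane_derivable..].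
by rewrite /GRing.scale/= addrC mulrC.
Qed.

Lemma D_comp a f v x : C1line a -> C1plane f ->
  'D_v (fun z => a (f z)) x = derive1 a (f x) * 'D_v f x.
Proof.
move=> [da _] [df _].
have daf : differentiable a (f x) by apply/derivable1_diffP.
rewrite (_ : (fun z => a (f z)) = a \o f)// deriveE; last exact: differentiable_comp.
rewrite diff_comp// deriveE//=.
by rewrite deriv1E// /GRing.scale/= mulrC.
Qed.

Lemma C1plane_cst (k : R) : C1plane (fun=> k).
Proof.
split=> [x|v]; first exact: differentiable_cst.
rewrite (_ : 'D_v _ = fun=> 0); first by move=> x; exact: cvg_cst.
by apply/funext => x; exact: derive_cst.
Qed.

Lemma C1plane_add f g : C1plane f -> C1plane g -> C1plane (fun z => f z + g z).
Proof.
move=> Cf Cg; split=> [x|v].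
  by apply: differentiableD; [exact: Cf.1|exact: Cg.1].
rewrite (_ : 'D_v _ = fun x => 'D_v f x + 'D_v g x); last first.
  by apply/funext => x; exact: D_add.
by move=> x; apply: cvgD; [exact: Cf.2|exact: Cg.2].
Qed.

Lemma C1plane_mul f g : C1plane f -> C1plane g -> C1plane (fun z => f z * g z).
Proof.
move=> Cf Cg; split=> [x|v].
  by apply: differentiableM; [exact: Cf.1|exact: Cg.1].
rewrite (_ : 'D_v _ = fun x => 'D_v f x * g x + f x * 'D_v g x); last first.
  by apply/funext => x; exact: D_mul.
by move=> x; apply: cvgD; apply: cvgM;
  [exact: Cf.2|exact: C1plane_continuous|exact: C1plane_continuous|exact: Cg.2].
Qed.

Lemma C1plane_comp a f : C1line a -> C1plane f -> C1plane (fun z => a (f z)).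
Proof.
move=> Ca Cf; split=> [x|v].
  rewrite (_ : (fun z => a (f z)) = a \o f)//; apply: differentiable_comp.
    exact: Cf.1.
  by apply/derivable1_diffP; exact: Ca.1.
rewrite (_ : 'D_v _ = fun x => derive1 a (f x) * 'D_v f x); last first.
  by apply/funext => x; exact: D_comp.
move=> x; apply: cvgM; last exact: Cf.2.
apply: (@continuous_comp _ _ _ f (derive1 a)); first exact: C1plane_continuous.
exact: Ca.2.
Qed.

Let fstL : {linear (R * R)%type -> R} := fst.
Let sndL : {linear (R * R)%type -> R} := snd.

Let continuous_fstL : continuous fstL. Proof. by move=> ?; exact: cvg_fst. Qed.
Let continuous_sndL : continuous sndL. Proof. by move=> ?; exact: cvg_snd. Qed.

Lemma D_fst v x : 'D_v (@fst R R) x = v.1.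
Proof.
have dl := linear_differentiable x continuous_fstL.
by rewrite deriveE// (diff_lin _ continuous_fstL).
Qed.

Lemma D_snd v x : 'D_v (@snd R R) x = v.2.
Proof.
have dl := linear_differentiable x continuous_sndL.
by rewrite deriveE// (diff_lin _ continuous_sndL).
Qed.

Lemma C1plane_fst : C1plane (@fst R R).
Proof.
split=> [x|v]; first exact: (linear_differentiable x continuous_fstL).
rewrite (_ : 'D_v _ = fun=> v.1); first by move=> x; exact: cvg_cst.
by apply/funext => x; exact: D_fst.
Qed.

Lemma C1plane_snd : C1plane (@snd R R).
Proof.
split=> [x|v]; first exact: (linear_differentiable x continuous_sndL).
rewrite (_ : 'D_v _ = fun=> v.2); first by move=> x; exact: cvg_cst.
by apply/funext => x; exact: D_snd.
Qed.

Lemma C1plane_opp f : C1plane f -> C1plane (fun z => - f z).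
Proof.
move=> Cf; rewrite (_ : (fun _ => _) = fun z => (-1) * f z).
  by apply: C1plane_mul => //; exact: C1plane_cst.
by apply/funext => z; rewrite mulN1r.
Qed.

Lemma D_cst (k : R) v x : 'D_v (fun=> k) x = 0.
Proof. exact: derive_cst. Qed.

Lemma D_opp f v x : C1plane f -> 'D_v (fun z => - f z) x = - 'D_v f x.
Proof. by move=> Cf; rewrite -deriveN//; exact: C1plane_derivable. Qed.

Lemma C1plane_components (phi : R * R -> R * R) :
  (forall x, differentiable phi x) -> (forall v, continuous ('D_v phi)) ->
  C1plane (fst \o phi) /\ C1plane (snd \o phi).
Proof.
move=> dphi Dphi.
have dl1 x := linear_differentiable x continuous_fstL.
have dl2 x := linear_differentiable x continuous_sndL.
split; split=> [x|v].
- exact: differentiable_comp.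
- rewrite (_ : 'D_v _ = fst \o 'D_v phi).
    by move=> x; apply: continuous_comp; [exact: Dphi|exact: cvg_fst].
  apply/funext => x; rewrite !deriveE//; last exact: differentiable_comp.
  by rewrite diff_comp//= (diff_lin _ continuous_fstL)/= deriveE.
- exact: differentiable_comp.
- rewrite (_ : 'D_v _ = snd \o 'D_v phi).
    by move=> x; apply: continuous_comp; [exact: Dphi|exact: cvg_snd].
  apply/funext => x; rewrite !deriveE//; last exact: differentiable_comp.
  by rewrite diff_comp//= (diff_lin _ continuous_sndL)/= deriveE.
Qed.

Lemma C1plane_pair f g : C1plane f -> C1plane g ->
  (forall x, differentiable (fun z => (f z, g z)) x) /\
  forall v, continuous ('D_v (fun z => (f z, g z))).
Proof.
move=> [df Df] [dg Dg].
have dfg x : differentiable (fun z => (f z, g z)) x by exact: differentiable_pair.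
split=> // v.
rewrite (_ : 'D_v _ = fun x => ('D_v f x, 'D_v g x)).
  by move=> x; exact: (cvg_pair (Df v x) (Dg v x)).
by apply/funext => x; rewrite !deriveE// diff_pair.
Qed.

End C1.

(** * Functions of bounded support *)

Definition box (R : realType) (M : R) : set (R * R) :=
  [set x | `|x.1| <= M /\ `|x.2| <= M].

(** For a pair of components this amounts to compact support, by [compact_support_pair], and it
    passes to sums and products at once. *)
Definition bounded_support (R : realType) (f : R * R -> R) :=
  exists M : R, forall x, ~ box M x -> f x = 0.

Section support.
Context {R : realType}.
Implicit Types (f g : R * R -> R) (x : R * R).

Lemma boxE (M : R) : box M = `[- M, M] `*` `[- M, M].
Proof.
by apply/seteqP; split => x; rewrite /box/= !in_itv/= ?ler_norml.
Qed.

Lemma le_box (M N : R) : M <= N -> box M `<=` box N.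
Proof. by move=> MN x [? ?]; split; apply: le_trans MN. Qed.

Lemma compact_box (M : R) : compact (box M).
Proof. by rewrite boxE; apply: compact_setX; exact: segment_compact. Qed.

Lemma closed_box (M : R) : closed (box M).
Proof.
apply: compact_closed; last exact: compact_box.
exact: norm_hausdorff.
Qed.

Lemma bounded_set_box (A : set (R * R)) : bounded_set A -> exists M, A `<=` box M.
Proof.
move=> [M [_ AM]]; exists (M + 1) => x Ax.
have /= := AM (M + 1) (ltac:(by rewrite ltrDl)) x Ax.
by rewrite prod_normE /= ge_max => /andP[].
Qed.

Lemma compact_support_pair f g :
  compact (closure [set x | (f x, g x) != 0]) <->
  bounded_support f /\ bounded_support g.
Proof.
split=> [/compact_bounded/bounded_set_box[M HM]|[[M fM] [N gN]]].
  have fg0 x : ~ box M x -> (f x, g x) = 0.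
    move=> bx; apply: contrapT => fgx; apply: bx; apply: HM.
    by apply: subset_closure => /=; apply/eqP.
  by split; exists M => x /fg0[].
apply: (@subclosed_compact _ _ (box (Num.max M N))).
- exact: closed_closure.
- exact: compact_box.
- rewrite [X in _ `<=` X](closure_id _).1; last exact: closed_box.
  apply: closureS => x /= fgx; apply: contrapT => bx; move/eqP: fgx; apply.
  by rewrite fM ?gN// => h; apply: bx; apply: le_box h; rewrite le_max lexx ?orbT.
Qed.

Lemma bounded_support_mull f g : bounded_support f ->
  bounded_support (fun x => f x * g x).
Proof. by move=> [M fM]; exists M => x /fM ->; rewrite mul0r. Qed.

Lemma bounded_support_add f g : bounded_support f -> bounded_support g ->
  bounded_support (fun x => f x + g x).
Proof.
move=> [M fM] [N gN]; exists (Num.max M N) => x bx.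
by rewrite fM ?gN ?addr0// => h; apply: bx; apply: le_box h;
  rewrite le_max lexx ?orbT.
Qed.

Lemma bounded_support_opp f : bounded_support f ->
  bounded_support (fun x => - f x).
Proof. by move=> [M fM]; exists M => x /fM ->; rewrite oppr0. Qed.

Lemma bounded_support_D f v : bounded_support f -> bounded_support ('D_v f).
Proof.
move=> [M fM]; exists M => x bx.
have : \forall y \near x, f y = 0.
  have : open (~` box M) by rewrite openC; exact: closed_box.
  rewrite openE => /(_ x bx); apply: filterS => y; exact: fM.
move=> f0; rewrite (near_eq_derive _ f0).
exact: derive_cst.
Qed.

Lemma bounded_bounded_support f : continuous f -> bounded_support f ->
  exists K, 0 <= K /\ forall x, `|f x| <= K.
Proof.
move=> cf [M fM].
have /compact_bounded[K [_ HK]] : compact (f @` box M).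
  apply: continuous_compact; last exact: compact_box.
  exact: continuous_subspaceT.
exists (Num.max 0 (K + 1)); split; first by rewrite le_max lexx.
move=> x; have [bx|bx] := pselect (box M x); last first.
  by rewrite fM// normr0 le_max lexx.
rewrite le_max; apply/orP; right; apply: (HK (K + 1)); last by exists x.
by rewrite ltrDl.
Qed.

End support.

(** * Lebesgue measure and the divergence theorem in the plane *)

Section measure.
Context {R : realType}.
Notation T := (lebesgue_plane R).
Notation B := (measurableTypeR R * measurableTypeR R)%type.
Notation mu := (lebesgue_measure2 R).

(** The sigma-algebra of [B] is generated by rectangles, so second countability has to enter: an
    open set is the union of the countably many rational squares that it contains. *)
Lemma open_borel_plane (A : set (R * R)) : open A -> measurable (A : set B).
Proof.
move=> oA.
pose sq (i : (rat * rat) * rat) : set (R * R) :=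
  [set x | `|ratr i.1.1 - x.1| < ratr i.2 /\ `|ratr i.1.2 - x.2| < ratr i.2].
have -> : A = \bigcup_(i in [set i | sq i `<=` A]) sq i.
  apply/seteqP; split => [x Ax|x [i /= iA ix]]; last exact: iA.
  move: oA; rewrite openE => /(_ x Ax)/nbhs_ballP[e /= e0 xeA].
  have [r] : exists r : rat, ratr r \in `]0, (e / 2)[.
    by apply: rat_in_itvoo; rewrite divr_gt0.
  rewrite in_itv/= => /andP[r0 re].
  have near1 (y : R) : exists q : rat, `|ratr q - y| < ratr r.
    have [q] : exists q : rat, ratr q \in `](y - ratr r), (y + ratr r)[.
      by apply: rat_in_itvoo; lra.
    by rewrite in_itv/= => qy; exists q; rewrite ltr_distl.
  have [q1 q1x] := near1 x.1; have [q2 q2x] := near1 x.2.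
  exists ((q1, q2), r) => //= y [/= y1 y2]; apply: xeA; split => /=.
    rewrite /ball/= (le_lt_trans (ler_distD (ratr q1) _ _))//.
    by rewrite (distrC x.1); lra.
  rewrite /ball/= (le_lt_trans (ler_distD (ratr q2) _ _))//.
  by rewrite (distrC x.2); lra.
rewrite bigcup_mkcond; apply: countable_bigcupT_measurable => [|i].
  exact: countableP.
case: ifPn => // _.
rewrite (_ : sq i = [set x | `|ratr i.1.1 - x| < ratr i.2] `*`
   [set x | `|ratr i.1.2 - x| < ratr i.2])//.
apply: measurableX.
  rewrite (_ : [set x | _] = ball (ratr i.1.1 : R) (ratr i.2))//; exact: measurable_ball.
rewrite (_ : [set x | _] = ball (ratr i.1.2 : R) (ratr i.2))//; exact: measurable_ball.
Qed.

Lemma continuous_borel_plane (f : R * R -> R) : continuous f ->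
  measurable_fun [set: B] (f : B -> R).
Proof.
move/continuousP => cf; apply: (measurability _ (RGenOpens.measurableE R)).
move=> _ [_ [a [b ->] <-]]; rewrite setTI; apply: open_borel_plane.
exact/cf/interval_open.
Qed.

Lemma borel_lebesgue_plane (A : set (R * R)) :
  measurable (A : set B) -> measurable (A : set T).
Proof. exact: caratheodory_measurable_mu_ext. Qed.

Lemma lebesgue_measure2E (A : set (R * R)) :
  measurable (A : set B) -> mu A = borel_measure2 R A.
Proof. by move=> mA; exact: measurable_mu_extE. Qed.

Lemma borel_lebesgue_fun (f : R * R -> R) :
  measurable_fun [set: B] (f : B -> R) -> measurable_fun [set: T] (f : T -> R).
Proof. by move=> mf _ Y mY; apply: borel_lebesgue_plane; exact: mf. Qed.


Lemma borel_box (M : R) : measurable (box M : set B).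
Proof. by rewrite boxE; apply: measurableX; exact: measurable_itv. Qed.

Lemma measurable_box (M : R) : measurable (box M : set T).
Proof. by apply: borel_lebesgue_plane; exact: borel_box. Qed.

Lemma box_lty (M : R) : (mu (box M) < +oo)%E.
Proof.
rewrite lebesgue_measure2E; last exact: borel_box.
pose I : set (measurableTypeR R) := [set` `[(- M), M]%R].
have mI : measurable I by exact: measurable_itv.
rewrite (_ : box M = I `*` I); last exact: boxE.
rewrite (_ : borel_measure2 R (I `*` I) =
  (lebesgue_measure I * lebesgue_measure I)%E); last exact: product_measure1E.
have If : lebesgue_measure I \is a fin_num.
  by rewrite /I lebesgue_measure_itv/=; case: ifP.
by rewrite ltey_eq fin_numM.
Qed.

Lemma plane_integrable (f : R * R -> R) (D : set T) : measurable D ->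
  continuous f -> bounded_support f -> mu.-integrable D (EFin \o f).
Proof.
move=> mD cf bf; apply: (@integrableS _ _ _ _ setT) => //.
have [K [K0 fK]] := bounded_bounded_support cf bf.
move: bf => [M fM].
have -> : EFin \o f = (EFin \o f) \_ (box M).
  apply/funext => x; rewrite patchE; case: ifPn => // /negP xM /=.
  by rewrite fM// => h; apply: xM; rewrite inE.
apply/(integrable_mkcond _ (measurable_box M)).
apply: measurable_bounded_integrable.
- exact: measurable_box.
- exact: box_lty.
- by apply: measurable_funTS; apply: borel_lebesgue_fun; exact: continuous_borel_plane.
- exists K; split => [|y Ky x _]; first by rewrite num_real.
  exact: le_trans (fK x) (ltW Ky).
Qed.

(** Moves integrals to the product measure, where Fubini applies: the identity from the completed
    plane to the Borel plane is measurable and pushes the first measure forward to the second. *)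
Lemma plane_integralE (f : R * R -> R) : continuous f -> bounded_support f ->
  (\int[mu]_x (f x)%:E = \int[borel_measure2 R]_x (f x)%:E)%E.
Proof.
move=> cf bf.
pose phi (x : T) : B := x.
have mphi : measurable_fun setT phi.
  by move=> _ Y mY; rewrite setTI; exact: borel_lebesgue_plane.
have mf : measurable_fun [set: B] (EFin \o f).
  by apply/measurable_EFinP; exact: continuous_borel_plane.
have intf : mu.-integrable (phi @^-1` setT) ((EFin \o f) \o phi).
  exact: (@plane_integrable f setT measurableT cf bf).
have := integral_pushforward mphi mf intf measurableT.
rewrite preimage_setT/= => <-.
apply: eq_measure_integral => A mA _ /=.
by rewrite /pushforward preimage_id lebesgue_measure2E.
Qed.

End measure.

(** * Calculus on the line *)

Section line.
Context {R : realType}.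
Implicit Types (f F : R -> R).
Notation leb := (@lebesgue_measure R).

Lemma derive1_FTC2 F (a b : R) : a < b -> C1line F ->
  (\int[leb]_(x in `[a, b]) (derive1 F x)%:E = (F b - F a)%:E)%E.
Proof.
move=> ab CF; rewrite (@continuous_FTC2 _ (derive1 F) F a b)//.
- by apply: continuous_subspaceT; exact: CF.2.
- by split=> [x _||]; [exact: CF.1
    |exact/cvg_at_right_filter/C1line_continuous
    |exact/cvg_at_left_filter/C1line_continuous].
Qed.

Lemma continuous_itv_integrable f (a b : R) : continuous f ->
  leb.-integrable `[a, b] (EFin \o f).
Proof.
move=> cf; apply: continuous_compact_integrable; first exact: segment_compact.
exact: continuous_subspaceT.
Qed.

Lemma primitive_continuous f : continuous f ->
  exists F, (forall x, derivable F x 1) /\ derive1 F = f.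
Proof.
move=> cf.
(* [G n] is a primitive to the right of [- n], normalised to vanish at 0. The normalisation makes
   [G n] and [G m] agree on their common domain, so they glue to a primitive on the whole line. *)
pose G (n : nat) (x : R) : R := \int[leb]_(t in `[(- n%:R)%R, x]) f t -
              \int[leb]_(t in `[(- n%:R)%R, 0%R]) f t.
have GE n m (x : R) : (n <= m)%N -> - n%:R <= x -> G m x = G n x.
  move=> nm nx.
  have aux y : - n%:R <= y -> \int[leb]_(t in `[(- m%:R)%R, y]) f t =
      \int[leb]_(t in `[(- m%:R)%R, (- n%:R)%R]) f t +
      \int[leb]_(t in `[(- n%:R)%R, y]) f t.
    move=> ny; rewrite -(@Rintegral_itv_obnd_cbnd _ (- n%:R)); last first.
      apply: integrableS (continuous_itv_integrable (- n%:R) y cf) => //.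
      exact: subset_itv_oc_cc.
    rewrite -(@Rintegral_itvB _ f (BLeft (- m%:R)) (BRight y) (- n%:R)).
    - by rewrite addrC subrK.
    - exact: continuous_itv_integrable.
    - by rewrite bnd_simp lerN2 ler_nat.
    - by rewrite bnd_simp.
  by rewrite /G (aux x)// (aux 0) ?oppr_le0// opprD addrACA subrr add0r.
have DG n (x : R) : - n%:R < x -> derivable (G n) x 1 /\ derive1 (G n) x = f x.
  move=> nx; pose H (y : R) : R := \int[leb]_(t in `[(- n%:R)%R, y]) f t.
  have [d1 d2] : derivable H x 1 /\ derive1 H x = f x.
    apply: (@continuous_FTC1_closed _ f (- n%:R) x (x + 1)) => //.
    - by rewrite ltrDl.
    - exact: continuous_itv_integrable.
    - exact: cf.
  have -> : G n = H - cst (H 0) by apply/funext.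
  have dk := @derivable_cst _ R R (H 0) x 1.
  split; first exact: (derivableB d1 dk).
  by rewrite derive1E (deriveB d1 dk) derive_cst subr0 -derive1E.
clearbody G.
pose N (x : R) : nat := (Num.truncn `|x|).+1.
have N_gt (x : R) : - (N x)%:R < x.
  by rewrite ltrNl (le_lt_trans _ (truncnS_gt _))// -normrN ler_norm.
pose F (x : R) : R := G (N x) x.
have FG x : \forall y \near x, F y = G (N x) y.
  near=> y; rewrite /F.
  have : - (N x)%:R < y by near: y; exact: lt_nbhsr.
  move=> /ltW xy; have /ltW yy := N_gt y.
  by case/orP: (leq_total (N x) (N y)) => xyN; [|apply/esym]; exact: GE.
exists F; split=> [x|].
  have [d _] := DG _ _ (N_gt x).
  have GF : {near x, G (N x) =1 F} by near=> y; apply/esym; near: y; exact: FG.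
  exact: near_eq_derivable GF d.
apply/funext => x; have [_ DGx] := DG _ _ (N_gt x).
transitivity (derive1 (G (N x)) x); last by [].
by rewrite 2!derive1E; exact: (near_eq_derive _ (FG x)).
Unshelve. all: by end_near. Qed.

End line.

Section divergence_theorem.
Context {R : realType}.
Implicit Types (f : R * R -> R) (x y : R).
Notation leb := (@lebesgue_measure R).
Notation mu := (lebesgue_measure2 R).

Lemma derive1_slice1 f y x : derive1 (fun x => f (x, y)) x = 'D_(1, 0) f (x, y).
Proof.
rewrite derive1E /derive.
rewrite (_ : (fun h : R => h^-1 *: (f (h *: (1, 0) + (x, y)) - f (x, y))) =
  fun h => h^-1 *: (f (h *: (1:R) + x, y) - f (x, y)))//.
apply/funext => h; congr (_ *: (f _ - _)).
by congr (_, _); rewrite /= /GRing.scale/= ?mulr0 ?add0r.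
Qed.

Lemma derive1_slice2 f y x : derive1 (fun y => f (x, y)) y = 'D_(0, 1) f (x, y).
Proof.
rewrite derive1E /derive.
rewrite (_ : (fun h : R => h^-1 *: (f (h *: (0, 1) + (x, y)) - f (x, y))) =
  fun h => h^-1 *: (f (x, h *: (1:R) + y) - f (x, y)))//.
apply/funext => h; congr (_ *: (f _ - _)).
by congr (_, _); rewrite /= /GRing.scale/= ?mulr0 ?add0r.
Qed.

Lemma derivable_slice1 f y x : derivable f (x, y) (1, 0) ->
  derivable (fun x => f (x, y)) x 1.
Proof.
rewrite /derivable.
rewrite (_ : (fun h : R => h^-1 *: (f (h *: (1, 0) + (x, y)) - f (x, y))) =
  fun h => h^-1 *: (f (h *: (1:R) + x, y) - f (x, y)))//.
apply/funext => h; congr (_ *: (f _ - _)).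
by congr (_, _); rewrite /= /GRing.scale/= ?mulr0 ?add0r.
Qed.

Lemma derivable_slice2 f y x : derivable f (x, y) (0, 1) ->
  derivable (fun y => f (x, y)) y 1.
Proof.
rewrite /derivable.
rewrite (_ : (fun h : R => h^-1 *: (f (h *: (0, 1) + (x, y)) - f (x, y))) =
  fun h => h^-1 *: (f (x, h *: (1:R) + y) - f (x, y)))//.
apply/funext => h; congr (_ *: (f _ - _)).
by congr (_, _); rewrite /= /GRing.scale/= ?mulr0 ?add0r.
Qed.

Lemma continuous_slice1 f y : continuous f -> continuous (fun x => f (x, y)).
Proof.
move=> cf x; apply: (@continuous_comp _ _ _ (fun x => (x, y)) f); last exact: cf.
exact: (cvg_pair cvg_id (cvg_cst y)).
Qed.

Lemma continuous_slice2 f x : continuous f -> continuous (fun y => f (x, y)).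
Proof.
move=> cf y; apply: (@continuous_comp _ _ _ (fun y => (x, y)) f); last exact: cf.
exact: (cvg_pair (cvg_cst x) cvg_id).
Qed.

Lemma C1line_slice1 f y : C1plane f -> C1line (fun x => f (x, y)).
Proof.
move=> Cf; split=> [x|]; first exact/derivable_slice1/C1plane_derivable.
rewrite (_ : derive1 _ = fun x => 'D_(1, 0) f (x, y)).
  exact: (@continuous_slice1 ('D_(1, 0) f) y (Cf.2 _)).
by apply/funext => x; exact: derive1_slice1.
Qed.

Lemma C1line_slice2 f x : C1plane f -> C1line (fun y => f (x, y)).
Proof.
move=> Cf; split=> [y|]; first exact/derivable_slice2/C1plane_derivable.
rewrite (_ : derive1 _ = fun y => 'D_(0, 1) f (x, y)).
  exact: (@continuous_slice2 ('D_(0, 1) f) x (Cf.2 _)).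
by apply/funext => y; exact: derive1_slice2.
Qed.

Lemma integral_derive1_bounded_support (F : R -> R) (M : R) : C1line F ->
  (forall x, M < `|x| -> F x = 0) ->
  (\int[leb]_x (derive1 F x)%:E = 0)%E.
Proof.
move=> CF FM.
(* [L] exceeds [M], so [F] vanishes already at the endpoints [L] and [- L]. *)
pose L := `|M| + 1.
have L0 : 0 < L by rewrite ltr_pwDr.
have LM : M < L by rewrite (le_lt_trans (ler_norm _))// ltrDl.
have FL x : L <= `|x| -> F x = 0 by move=> Lx; apply: FM; exact: lt_le_trans Lx.
have DL x : L < `|x| -> derive1 F x = 0.
  move=> Lx; rewrite derive1E (@near_eq_derive _ _ _ _ (cst 0)) ?derive_cst//.
  near=> y; apply: FL; apply: ltW; near: y.
  apply: (@cvgr_gt _ _ _ _ _ (`|x|)) => //.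
  exact: (@norm_continuous _ R).
transitivity (\int[leb]_(x in `[(- L)%R, L]) (derive1 F x)%:E)%E.
  rewrite [RHS]integral_mkcond; apply: eq_integral => x _.
  rewrite patchE; case: ifPn => // /negP xL /=; rewrite DL// ltNge.
  by apply/negP; rewrite ler_norml => h; apply: xL; rewrite inE/= in_itv.
rewrite derive1_FTC2//; last by rewrite gt0_cp.
by rewrite !FL ?subrr// ?normrN ?ger0_norm// ltW.
Unshelve. all: by end_near. Qed.

Let integrable_borel f : continuous f -> bounded_support f ->
  (leb \x leb)%E.-integrable setT (EFin \o f).
Proof.
move=> cf bf; apply/integrableP; split.
  by apply/measurable_EFinP; exact: continuous_borel_plane.
have cnf : continuous (fun z => `|f z|).
  by move=> z; apply: continuous_comp; [exact: cf|exact: norm_continuous].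
have bnf : bounded_support (fun z => `|f z|).
  by move: bf => [M fM]; exists M => z /fM ->; rewrite normr0.
have := plane_integrable (D := setT) measurableT cnf bnf.
move=> /integrableP[_]; apply: le_lt_trans.
rewrite (_ : \int[mu]_x _ = \int[mu]_x (`|f x|)%:E)%E; last first.
  by apply: eq_integral => z _ /=; rewrite normr_id.
by rewrite plane_integralE.
Qed.

(** Fubini reduces the claim to horizontal lines, on which the fundamental theorem of calculus gives
    0. *)
Lemma integral_D1 f : C1plane f -> bounded_support f ->
  (\int[mu]_z ('D_(1%R, 0%R) f z)%:E = 0)%E.
Proof.
move=> Cf [M fM].
have cD : continuous ('D_(1, 0) f) by exact: Cf.2.
have bD : bounded_support ('D_(1, 0) f) by apply: bounded_support_D; exists M.
rewrite plane_integralE//.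
rewrite -(integral21_prod_meas1 (integrable_borel cD bD)).
rewrite -[RHS](integral0 leb setT); apply: eq_integral => y _.
rewrite /fubini_G/= -(@integral_derive1_bounded_support (fun x => f (x, y)) M).
- by apply: eq_integral => x _; rewrite derive1_slice1.
- exact: C1line_slice1.
- by move=> x Mx; apply: fM => -[/=]; rewrite leNgt Mx.
Qed.

Lemma integral_D2 f : C1plane f -> bounded_support f ->
  (\int[mu]_z ('D_(0%R, 1%R) f z)%:E = 0)%E.
Proof.
move=> Cf [M fM].
have cD : continuous ('D_(0, 1) f) by exact: Cf.2.
have bD : bounded_support ('D_(0, 1) f) by apply: bounded_support_D; exists M.
rewrite plane_integralE//.
rewrite -(integral12_prod_meas1 (integrable_borel cD bD)).
rewrite -[RHS](integral0 leb setT); apply: eq_integral => x _.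
rewrite /fubini_F/= -(@integral_derive1_bounded_support (fun y => f (x, y)) M).
- by apply: eq_integral => y _; rewrite derive1_slice2.
- exact: C1line_slice2.
- by move=> y My; apply: fM => -[_ /=]; rewrite leNgt My.
Qed.

End divergence_theorem.

(** * Perimeter and fluxes *)

Section perimeter.
Context {R : realType}.
Implicit Types (f g : R * R -> R).
Notation T := (lebesgue_plane R).
Notation mu := (lebesgue_measure2 R).

Definition plane_div f g (x : R * R) : R := 'D_(1, 0) f x + 'D_(0, 1) g x.

Definition admissible f g :=
  [/\ C1plane f, C1plane g, bounded_support f & bounded_support g].

Definition test_field f g :=
  admissible f g /\ forall x, f x ^+ 2 + g x ^+ 2 <= 1.

Lemma plane_div_continuous f g : C1plane f -> C1plane g -> continuous (plane_div f g).
Proof. by move=> Cf Cg x; apply: cvgD; [exact: Cf.2|exact: Cg.2]. Qed.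

Lemma plane_div_bounded_support f g : bounded_support f -> bounded_support g ->
  bounded_support (plane_div f g).
Proof. by move=> bf bg; apply: bounded_support_add; exact: bounded_support_D. Qed.

Lemma plane_div_integrable f g (S : set T) : measurable S -> admissible f g ->
  mu.-integrable S (EFin \o plane_div f g).
Proof.
move=> mS [Cf Cg bf bg]; apply: plane_integrable => //.
  exact: plane_div_continuous.
exact: plane_div_bounded_support.
Qed.

Lemma plane_div_bounded f g : admissible f g ->
  exists K, 0 <= K /\ forall x, `|plane_div f g x| <= K.
Proof.
move=> [Cf Cg bf bg]; apply: bounded_bounded_support.
  exact: plane_div_continuous.
exact: plane_div_bounded_support.
Qed.

(** For a regular [S] this is the outward flux through the boundary, by the divergence theorem. The
    volume form makes sense for every measurable [S], and the perimeter is its supremum over test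
    fields. *)
Definition flux (S : set (R * R)) f g : R := \int[mu]_(x in (S : set T)) plane_div f g x.

Lemma fluxE (S : set T) f g : measurable S -> admissible f g ->
  (\int[mu]_x (\1_S x * plane_div f g x)%:E)%E = (flux S f g)%:E.
Proof.
move=> mS afg; rewrite /flux /Rintegral fineK; last first.
  by apply: integrable_fin_num => //; exact: plane_div_integrable.
rewrite [RHS]integral_mkcond; apply: eq_integral => x _.
rewrite patchE indicE; case: ifPn => xS; first by rewrite mul1r.
by rewrite mul0r.
Qed.

Lemma admissibleP f g : admissible f g <->
  C1_compact_support (fun x => (f x, g x)).
Proof.
split=> [[Cf Cg bf bg]|[dfg Dfg /compact_support_pair[bf bg]]].
  have [dfg Dfg] := C1plane_pair Cf Cg.
  by split=> //; apply/compact_support_pair.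
by have [] := C1plane_components dfg Dfg.
Qed.

Lemma euclid_norm_le1 (a b : R) : (euclid_norm (a, b) <= 1) = (a ^+ 2 + b ^+ 2 <= 1).
Proof.
rewrite /euclid_norm /= -{1}[1]sqrtr1 ler_sqrt//.
Qed.

Lemma perimeter_ge (S : set T) f g : measurable S -> test_field f g ->
  ((flux S f g)%:E <= perimeter S)%E.
Proof.
move=> mS [afg fg1]; apply: ereal_sup_ubound => /=.
exists (fun x => (f x, g x)); split; first exact/admissibleP.
  by move=> x; rewrite euclid_norm_le1.
by rewrite -fluxE.
Qed.

Lemma perimeter_le (S : set T) (P : R) : measurable S ->
  (forall f g, test_field f g -> flux S f g <= P) -> (perimeter S <= P%:E)%E.
Proof.
move=> mS HP; apply: ge_ereal_sup => _ [phi [Cphi phi1 ->]].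
have phiE : phi = fun x => (fst (phi x), snd (phi x)).
  by apply/funext => x; rewrite -surjective_pairing.
have afg : admissible (fst \o phi) (snd \o phi).
  by apply/admissibleP; rewrite -phiE.
rewrite [X in (X <= _)%E](fluxE mS afg) lee_fin; apply: HP; split => // x /=.
by rewrite -euclid_norm_le1 -surjective_pairing.
Qed.

Lemma perimeter_ge0 (S : set (R * R)) : (0 <= perimeter S)%E.
Proof.
apply: ereal_sup_ubound => /=; exists (fun=> (0, 0)); split.
- apply/admissibleP; split; [exact: C1plane_cst|exact: C1plane_cst| |];
    by exists 0.
- by move=> x; rewrite euclid_norm_le1 expr0n addr0.
- rewrite (_ : \int[_]_x _ = \int[mu]_x 0)%E ?integral0//.
  apply: integral0_eq => x _; rewrite /divergence.
  by rewrite (_ : fst \o _ = cst 0)// (_ : snd \o _ = cst 0)// !derive_cst addr0 mulr0.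
Qed.

Lemma flux_setU (A B : set T) f g : measurable A -> measurable B ->
  A `&` B = set0 -> admissible f g ->
  flux (A `|` B) f g = flux A f g + flux B f g.
Proof.
move=> mA mB AB afg; rewrite /flux Rintegral_setU//.
- by apply: plane_div_integrable => //; exact: measurableU.
- exact/disj_set2P.
Qed.

Lemma flux_setT f g : admissible f g -> flux setT f g = 0.
Proof.
move=> [Cf Cg bf bg]; rewrite /flux RintegralD//.
- by rewrite /Rintegral integral_D1// integral_D2//= addr0.
- by apply: plane_integrable => //; [exact: Cf.2|exact: bounded_support_D].
- by apply: plane_integrable => //; [exact: Cg.2|exact: bounded_support_D].
Qed.

Lemma flux_setC (A : set T) f g : measurable A -> admissible f g ->
  flux (~` A) f g = - flux A f g.
Proof.
move=> mA afg; apply/eqP; rewrite -addr_eq0 addrC -flux_setU//.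
- by rewrite setUCr flux_setT.
- exact: measurableC.
- by rewrite setICr.
Qed.

Lemma plane_divD f g f' g' x : C1plane f -> C1plane g -> C1plane f' -> C1plane g' ->
  plane_div (fun z => f z + f' z) (fun z => g z + g' z) x = plane_div f g x + plane_div f' g' x.
Proof. by move=> *; rewrite /plane_div !D_add//; ring. Qed.

Lemma admissibleD f g f' g' : admissible f g -> admissible f' g' ->
  admissible (fun z => f z + f' z) (fun z => g z + g' z).
Proof.
move=> [? ? ? ?] [? ? ? ?]; split; try exact: C1plane_add;
  exact: bounded_support_add.
Qed.

Lemma fluxD (S : set T) f g f' g' : measurable S ->
  admissible f g -> admissible f' g' ->
  flux S (fun z => f z + f' z) (fun z => g z + g' z) =
  flux S f g + flux S f' g'.
Proof.
move=> mS afg afg'; rewrite /flux -RintegralD//; [|exact: plane_div_integrable..].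
by apply: eq_Rintegral => x _; case: afg => ? ? _ _; case: afg' => ? ? _ _; exact: plane_divD.
Qed.

Lemma admissibleN f g : admissible f g ->
  admissible (fun z => - f z) (fun z => - g z).
Proof.
move=> [? ? ? ?]; split; try exact: C1plane_opp; exact: bounded_support_opp.
Qed.

Lemma fluxN (S : set T) f g : measurable S -> admissible f g ->
  flux S (fun z => - f z) (fun z => - g z) = - flux S f g.
Proof.
move=> mS afg; apply/eqP; rewrite -addr_eq0 -fluxD//; last exact: admissibleN.
apply/eqP; rewrite /flux.
rewrite (_ : plane_div _ _ = cst 0) ?Rintegral_cst ?mul0r//.
apply/funext => x; rewrite /plane_div.
rewrite (_ : (fun z => - f z + f z) = cst 0); last by apply/funext => z; rewrite addNr.
rewrite (_ : (fun z => - g z + g z) = cst 0); last by apply/funext => z; rewrite addNr.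
by rewrite !derive_cst addr0.
Qed.

Lemma test_fieldN f g : test_field f g ->
  test_field (fun z => - f z) (fun z => - g z).
Proof. by move=> [? fg1]; split => [|x]; [exact: admissibleN|rewrite !sqrrN]. Qed.

Lemma admissibleM h f g : C1plane h -> bounded_support h ->
  C1plane f -> C1plane g -> admissible (fun z => h z * f z) (fun z => h z * g z).
Proof.
by move=> *; split; [exact: C1plane_mul|exact: C1plane_mul
  |exact: bounded_support_mull|exact: bounded_support_mull].
Qed.

Lemma plane_divM h f g x : C1plane h -> C1plane f -> C1plane g ->
  plane_div (fun z => h z * f z) (fun z => h z * g z) x =
  h x * plane_div f g x + ('D_(1, 0) h x * f x + 'D_(0, 1) h x * g x).
Proof. by move=> *; rewrite /plane_div !D_mul//; ring. Qed.

End perimeter.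

(** * Radial cutoffs *)

Section smoothstep.
Context {R : realType}.
Implicit Types (t x : R).

Definition pospart t : R := Num.max t 0.

Lemma pospart_pos t : 0 <= t -> pospart t = t.
Proof. by move=> ?; rewrite /pospart max_l. Qed.

Lemma pospart_neg t : t <= 0 -> pospart t = 0.
Proof. by move=> ?; rewrite /pospart max_r. Qed.

Lemma pospart_continuous : continuous pospart.
Proof. by move=> t; apply: continuous_max; [exact: cvg_id|exact: cvg_cst]. Qed.

(** A second-order error bound uniform in [t], so that the kink of [pospart] at 0 needs no separate
    treatment when differentiating its square. *)
Lemma pospart_sq_expansion t h :
  `|pospart (h + t) ^+ 2 - pospart t ^+ 2 - 2 * pospart t * h| <= h ^+ 2.
Proof.
rewrite ler_norml; have [t0|/ltW t0] := leP 0 t; have [ht0|/ltW ht0] := leP 0 (h + t).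
- by rewrite !pospart_pos//; apply/andP; split; nra.
- by rewrite (pospart_neg ht0) (pospart_pos t0); apply/andP; split; nra.
- by rewrite (pospart_neg t0) (pospart_pos ht0); apply/andP; split; nra.
- by rewrite !pospart_neg//; apply/andP; split; nra.
Qed.

Lemma is_derive_pospart_sq t :
  is_derive t (1 : R) (fun x => pospart x ^+ 2) (2 * pospart t).
Proof.
have H : h^-1 *: (pospart (h *: 1 + t) ^+ 2 - pospart t ^+ 2) @[h --> 0^'] -->
    2 * pospart t.
  apply/cvgrPdist_le => e e0.
  near=> h.
  have h0 : h != 0 by near: h; exact: nbhs_dnbhs_neq.
  have he : `|h| <= e by near: h; apply: dnbhs0_le.
  rewrite {1}/GRing.scale/= [h *: 1]mulr1.
  apply: le_trans he; rewrite distrC.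
  rewrite -(ler_pM2l (x := `|h|)) ?normr_gt0// -normrM -expr2 real_normK ?num_real//.
  apply: le_trans (pospart_sq_expansion t h); rewrite le_eqVlt; apply/orP; left.
  by apply/eqP; congr (`|_|); field.
split; first by apply/cvg_ex; exists (2 * pospart t).
exact: (cvg_lim _ H).
Unshelve. all: by end_near. Qed.

(** The C1 quadratic spline rising from 0 to 1, with knots 0, 1/2 and 1, in truncated powers. Its
    derivative is the tent of height 2 over [0, 1]. *)
Definition smoothstep t : R :=
  2 * (pospart t ^+ 2 - 2 * pospart (t - 2^-1) ^+ 2 + pospart (t - 1) ^+ 2).

Definition smoothstep' t : R :=
  4 * (pospart t - 2 * pospart (t - 2^-1) + pospart (t - 1)).

Let pospart_cases t : (0 <= t /\ pospart t = t) \/ (t <= 0 /\ pospart t = 0).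
Proof.
have [t0|/ltW t0] := leP 0 t; first by left; rewrite pospart_pos.
by right; rewrite pospart_neg.
Qed.

Lemma smoothstep_le0 t : t <= 0 -> smoothstep t = 0.
Proof. by move=> t0; rewrite /smoothstep !pospart_neg; lra. Qed.

Lemma smoothstep_ge1 t : 1 <= t -> smoothstep t = 1.
Proof. by move=> t1; rewrite /smoothstep !pospart_pos; lra. Qed.

Lemma smoothstep_ge0 t : 0 <= smoothstep t.
Proof.
rewrite /smoothstep; have := pospart_cases t.
have := pospart_cases (t - 2^-1); have := pospart_cases (t - 1).
by move=> [] [h1 ->] [] [h2 ->] [] [h3 ->]; nra.
Qed.

Lemma smoothstep_le1 t : smoothstep t <= 1.
Proof.
rewrite /smoothstep; have := pospart_cases t.
have := pospart_cases (t - 2^-1); have := pospart_cases (t - 1).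
by move=> [] [h1 ->] [] [h2 ->] [] [h3 ->]; nra.
Qed.

Lemma smoothstep'_ge0 t : 0 <= smoothstep' t.
Proof.
rewrite /smoothstep'; have := pospart_cases t.
have := pospart_cases (t - 2^-1); have := pospart_cases (t - 1).
by move=> [] [h1 ->] [] [h2 ->] [] [h3 ->]; lra.
Qed.

Lemma smoothstep'_le2 t : smoothstep' t <= 2.
Proof.
rewrite /smoothstep'; have := pospart_cases t.
have := pospart_cases (t - 2^-1); have := pospart_cases (t - 1).
by move=> [] [h1 ->] [] [h2 ->] [] [h3 ->]; lra.
Qed.

Lemma smoothstep'_le0 t : t <= 0 -> smoothstep' t = 0.
Proof. by move=> t0; rewrite /smoothstep' !pospart_neg; lra. Qed.

Lemma smoothstep'_ge1 t : 1 <= t -> smoothstep' t = 0.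
Proof. by move=> t1; rewrite /smoothstep' !pospart_pos; lra. Qed.

Lemma is_derive_smoothstep t : is_derive t (1 : R) smoothstep (smoothstep' t).
Proof.
have sh (c x : R) : is_derive x (1 : R) (fun y => pospart (y - c) ^+ 2) (2 * pospart (x - c)).
  rewrite (_ : (fun y => _) = (fun y => pospart y ^+ 2) \o (fun y => y - c))//.
  have h2 : is_derive x (1:R) (fun y : R => y - c) 1.
    by apply: is_derive_eq; rewrite subr0.
  have h1 := is_derive_pospart_sq (x - c).
  have := @is_derive1_comp _ (fun y => pospart y ^+ 2) (fun y => y - c) x _ _ h1 h2.
  by rewrite mulr1.
have h0 := is_derive_pospart_sq t.
have h1 := sh 2^-1 t. have h2 := sh 1 t.
rewrite (_ : smoothstep = (2 : R) \*: ((fun y => pospart y ^+ 2) -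
   (2 : R) \*: (fun y => pospart (y - 2^-1) ^+ 2) + (fun y => pospart (y - 1) ^+ 2))).
  apply: is_derive_eq; rewrite /GRing.scale/= /smoothstep'; ring.
by apply/funext.
Qed.

Lemma derive1_smoothstep : derive1 smoothstep = smoothstep'.
Proof.
by apply/funext => t; rewrite derive1E; have [_] := is_derive_smoothstep t.
Qed.

Lemma C1line_smoothstep : C1line smoothstep.
Proof.
split=> [t|]; first by have [] := is_derive_smoothstep t.
rewrite derive1_smoothstep /smoothstep' => t.
have sh c : {for t, continuous (fun y => pospart (y - c))}.
  apply: (@continuous_comp _ _ _ (fun y => y - c) pospart); last exact: pospart_continuous.
  by apply: cvgB; [exact: cvg_id|exact: cvg_cst].
apply: cvgM; first exact: cvg_cst.
apply: cvgD; last exact: sh; apply: cvgB; first exact: pospart_continuous.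
by apply: cvgM; [exact: cvg_cst|exact: sh].
Qed.

End smoothstep.

Section cutoff.
Context {R : realType}.
Notation T := (lebesgue_plane R).
Notation B := (measurableTypeR R * measurableTypeR R)%type.
Notation mu := (lebesgue_measure2 R).
Implicit Types (c x : R * R) (a b t r : R).

Definition sqdist c x : R := (x.1 - c.1) ^+ 2 + (x.2 - c.2) ^+ 2.

Lemma sqdist_ge0 c x : 0 <= sqdist c x.
Proof. by rewrite addr_ge0// sqr_ge0. Qed.

Lemma euclid_ballE c r : 0 <= r -> euclid_ball c r = [set x | sqdist c x < r ^+ 2].
Proof.
move=> r0; apply/funext => x; apply/propext; rewrite /euclid_ball/= /euclid_norm/=.
rewrite -[X in X < r ^+ 2]sqr_sqrtr ?sqdist_ge0//.
by rewrite ltr_pXn2r// nnegrE sqrtr_ge0.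
Qed.

Lemma C1plane_fstB (k : R) : C1plane (fun x : R * R => x.1 - k).
Proof. exact: (C1plane_add C1plane_fst (C1plane_cst (- k))). Qed.

Lemma C1plane_sndB (k : R) : C1plane (fun x : R * R => x.2 - k).
Proof. exact: (C1plane_add C1plane_snd (C1plane_cst (- k))). Qed.

Lemma D_fstB (k : R) v x : 'D_v (fun x : R * R => x.1 - k) x = v.1.
Proof. by rewrite (D_add v x C1plane_fst (C1plane_cst (- k))) D_cst D_fst addr0. Qed.

Lemma D_sndB (k : R) v x : 'D_v (fun x : R * R => x.2 - k) x = v.2.
Proof. by rewrite (D_add v x C1plane_snd (C1plane_cst (- k))) D_cst D_snd addr0. Qed.

Let sqdistE c : sqdist c =
  fun x => (x.1 - c.1) * (x.1 - c.1) + (x.2 - c.2) * (x.2 - c.2).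
Proof. by apply/funext => x; rewrite /sqdist !expr2. Qed.

Let C1plane_fstB2 c := C1plane_mul (C1plane_fstB c.1) (C1plane_fstB c.1).
Let C1plane_sndB2 c := C1plane_mul (C1plane_sndB c.2) (C1plane_sndB c.2).

Lemma C1plane_sqdist c : C1plane (sqdist c).
Proof. by rewrite sqdistE; exact: C1plane_add. Qed.

Lemma D_sqdist c v x :
  'D_v (sqdist c) x = 2 * (v.1 * (x.1 - c.1) + v.2 * (x.2 - c.2)).
Proof.
rewrite sqdistE (D_add v x (C1plane_fstB2 c) (C1plane_sndB2 c)).
rewrite (D_mul v x (C1plane_fstB c.1) (C1plane_fstB c.1)).
rewrite (D_mul v x (C1plane_sndB c.2) (C1plane_sndB c.2)) D_fstB D_sndB.
by ring.
Qed.

Lemma sqdist_box c b : exists M, forall x, sqdist c x < b ^+ 2 -> box M x.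
Proof.
exists (`|b| + `|c.1| + `|c.2|) => x xb.
have aux (u v w : R) : (u - v) ^+ 2 + w ^+ 2 < b ^+ 2 -> `|u| <= `|b| + `|v|.
  move=> h; have : `|u - v| <= `|b|.
    rewrite -ler_sqr ?nnegrE// !real_normK ?num_real//.
    by have := sqr_ge0 w; lra.
  by move=> h2; have := ler_normD (u - v) v; rewrite subrK; lra.
have := normr_ge0 c.1; have := normr_ge0 c.2 => c1 c2.
split; first by have := aux _ _ _ xb; lra.
by move: xb; rewrite /sqdist addrC => /aux; lra.
Qed.

(** A function of the squared distance, which is polynomial, so that smoothness at the centre is
    automatic. *)
Definition cutoff c a b x : R := smoothstep ((b ^+ 2 - sqdist c x) / (b ^+ 2 - a ^+ 2)).

(** The gradient of the cutoff is minus this weight times [x - c]. *)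
Definition cutoff_weight c a b x : R :=
  2 * smoothstep' ((b ^+ 2 - sqdist c x) / (b ^+ 2 - a ^+ 2)) / (b ^+ 2 - a ^+ 2).

Variables (c : R * R) (a b : R).
Hypotheses (a0 : 0 < a) (ab : a < b).

Let ab2 : 0 < b ^+ 2 - a ^+ 2.
Proof. by rewrite subr_sqr mulr_gt0 ?subr_gt0 ?addr_gt0 ?(lt_trans a0 ab)//. Qed.

Let arg_le0 x : b ^+ 2 <= sqdist c x -> (b ^+ 2 - sqdist c x) / (b ^+ 2 - a ^+ 2) <= 0.
Proof. by move=> h; rewrite ler_pdivrMr// mul0r; lra. Qed.

Let arg_ge1 x : sqdist c x <= a ^+ 2 -> 1 <= (b ^+ 2 - sqdist c x) / (b ^+ 2 - a ^+ 2).
Proof. by move=> h; rewrite ler_pdivlMr// mul1r; lra. Qed.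

Let C1plane_arg1 :=
  C1plane_add (C1plane_cst (b ^+ 2)) (C1plane_opp (C1plane_sqdist c)).
Let C1plane_arg := C1plane_mul C1plane_arg1 (C1plane_cst (b ^+ 2 - a ^+ 2)^-1).

Lemma C1plane_cutoff : C1plane (cutoff c a b).
Proof. exact: (C1plane_comp C1line_smoothstep C1plane_arg). Qed.

Let gradient_arith (s k d : R) : s * (- (2 * d) * k) = - (2 * s * k) * d.
Proof. by ring. Qed.

Lemma D_cutoff v x : 'D_v (cutoff c a b) x =
  - cutoff_weight c a b x * (v.1 * (x.1 - c.1) + v.2 * (x.2 - c.2)).
Proof.
rewrite (D_comp v x C1line_smoothstep C1plane_arg) derive1_smoothstep.
rewrite (D_mul v x C1plane_arg1 (C1plane_cst _)) D_cst mulr0 addr0.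
rewrite (D_add v x (C1plane_cst _) (C1plane_opp (C1plane_sqdist c))) D_cst add0r.
rewrite (D_opp v x (C1plane_sqdist c)) D_sqdist /cutoff_weight.
exact: gradient_arith.
Qed.

Lemma cutoff_in x : sqdist c x <= a ^+ 2 -> cutoff c a b x = 1.
Proof. by move=> h; apply: smoothstep_ge1; exact: arg_ge1. Qed.

Lemma cutoff_out x : b ^+ 2 <= sqdist c x -> cutoff c a b x = 0.
Proof. by move=> h; apply: smoothstep_le0; exact: arg_le0. Qed.

Lemma cutoff_weight_in x : sqdist c x <= a ^+ 2 -> cutoff_weight c a b x = 0.
Proof.
by move=> h; rewrite /cutoff_weight smoothstep'_ge1 ?mulr0 ?mul0r//; exact: arg_ge1.
Qed.

Lemma cutoff_weight_out x : b ^+ 2 <= sqdist c x -> cutoff_weight c a b x = 0.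
Proof.
by move=> h; rewrite /cutoff_weight smoothstep'_le0 ?mulr0 ?mul0r//; exact: arg_le0.
Qed.

Lemma cutoff_weight_ge0 x : 0 <= cutoff_weight c a b x.
Proof.
by rewrite /cutoff_weight mulr_ge0 ?invr_ge0 ?(ltW ab2)// mulr_ge0// smoothstep'_ge0.
Qed.

(** The slope of the step is at most 2, differentiating the squared distance brings another 2, and
    [b / (b + a)] is at most 1. *)
Lemma cutoff_weight_le x : cutoff_weight c a b x * b <= 4 / (b - a).
Proof.
rewrite /cutoff_weight; set s := smoothstep' _.
have s2 : s <= 2 by exact: smoothstep'_le2.
have s0 : 0 <= s by exact: smoothstep'_ge0.
have a_gt0 := a0; have ba : 0 < b - a by rewrite subr_gt0.
have sba : 0 < b + a by lra.
have q1 : b / (b + a) <= 1 by rewrite ler_pdivrMr//; lra.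
have q0 : 0 <= b / (b + a) by rewrite divr_ge0//; lra.
rewrite subr_sqr (_ : _ * b = 2 * s * (b / (b + a)) / (b - a)); last first.
  by field; rewrite !gt_eqF.
rewrite ler_pM2r ?invr_gt0//; nra.
Qed.

Lemma cutoff_weight_le4 x : cutoff_weight c a b x * (b ^+ 2 - a ^+ 2) <= 4.
Proof.
rewrite /cutoff_weight divfK ?gt_eqF//.
rewrite (_ : 4 = 2 * 2); last by ring.
by rewrite ler_pM2l// smoothstep'_le2.
Qed.

Lemma bounded_support_cutoff : bounded_support (cutoff c a b).
Proof.
have [M HM] := sqdist_box c b; exists M => x bx; apply: cutoff_out.
by rewrite leNgt; apply/negP => /HM.
Qed.

Lemma cutoff_ge0 x : 0 <= cutoff c a b x. Proof. exact: smoothstep_ge0. Qed.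
Lemma cutoff_le1 x : cutoff c a b x <= 1. Proof. exact: smoothstep_le1. Qed.

Lemma cutoff_gradient_le f g x : f ^+ 2 + g ^+ 2 <= 1 ->
  `|'D_(1, 0) (cutoff c a b) x * f + 'D_(0, 1) (cutoff c a b) x * g| <= 4 / (b - a).
Proof.
have a_gt0 := a0; have ba := ab; move=> fg; rewrite !D_cutoff/=.
have [bx|xb] := leP (b ^+ 2) (sqdist c x).
  rewrite cutoff_weight_out// oppr0 !mul0r addr0 normr0.
  by rewrite divr_ge0//; lra.
apply: le_trans (cutoff_weight_le x).
set w := cutoff_weight _ _ _ _; have w0 : 0 <= w by exact: cutoff_weight_ge0.
set u := x.1 - c.1; set v := x.2 - c.2.
rewrite (_ : _ + _ = - w * (u * f + v * g)); last by ring.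
rewrite normrM normrN (ger0_norm w0) ler_wpM2l//.
rewrite -ler_sqr ?nnegrE//; last by lra.
rewrite real_normK ?num_real//.
have uv : u ^+ 2 + v ^+ 2 <= b ^+ 2 by exact: ltW.
have cs : (u * f + v * g) ^+ 2 <= (u ^+ 2 + v ^+ 2) * (f ^+ 2 + g ^+ 2).
  have := sqr_ge0 (u * g - v * f); nra.
apply: le_trans cs _; rewrite -[leRHS]mulr1.
by apply: ler_pM => //; rewrite addr_ge0 ?sqr_ge0.
Qed.

End cutoff.

(** * Areas as real numbers *)

Section area.
Context {R : realType}.
Notation T := (lebesgue_plane R).
Notation B := (measurableTypeR R * measurableTypeR R)%type.
Notation mu := (lebesgue_measure2 R).

Lemma measurable_euclid_ball (c : R * R) (r : R) : 0 <= r ->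
  measurable (euclid_ball c r : set T).
Proof.
move=> r0; apply: borel_lebesgue_plane; apply: open_borel_plane.
rewrite euclid_ballE//.
have cs : continuous (sqdist c) by apply: C1plane_continuous; exact: C1plane_sqdist.
rewrite (_ : [set x | _] = sqdist c @^-1` [set y | y < r ^+ 2])//.
by apply: open_comp => //; exact: open_lt.
Qed.

Lemma euclid_ball_lty (c : R * R) (r : R) : 0 <= r ->
  (mu (euclid_ball c r) < +oo)%E.
Proof.
move=> r0; have [M HM] := sqdist_box c r.
apply: le_lt_trans (box_lty M); apply: le_measure.
- by rewrite inE; exact: measurable_euclid_ball.
- by rewrite inE; exact: measurable_box.
- by move=> x; rewrite euclid_ballE//; exact: HM.
Qed.

Lemma euclid_ballS (c : R * R) (r s : R) : r <= s ->
  euclid_ball c r `<=` euclid_ball c s.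
Proof. by move=> rs x /lt_le_trans; exact. Qed.

Definition area (A : set (R * R)) : R := fine (mu A).

Lemma area_ge0 A : 0 <= area A.
Proof. by rewrite fine_ge0. Qed.

Definition finite_area (A : set (R * R)) :=
  measurable (A : set T) /\ (mu A < +oo)%E.

Lemma area_fin A : finite_area A -> mu A = (area A)%:E.
Proof. by move=> [_ Af]; rewrite fineK// ge0_fin_numE. Qed.

Lemma finite_areaS (A C : set (R * R)) : measurable (A : set T) -> A `<=` C ->
  finite_area C -> finite_area A.
Proof.
move=> mA AC [mC Cf]; split => //; apply: le_lt_trans Cf.
by apply: le_measure => //; rewrite inE.
Qed.

Lemma area_le (A C : set (R * R)) : measurable (A : set T) -> A `<=` C ->
  finite_area C -> area A <= area C.
Proof.
move=> mA AC fC; have fA := finite_areaS mA AC fC.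
rewrite -lee_fin -!area_fin//.
by apply: le_measure => //; rewrite inE; [case: fA|case: fC].
Qed.

Lemma area_setU (A C : set (R * R)) : finite_area A -> finite_area C ->
  A `&` C = set0 -> area (A `|` C) = area A + area C.
Proof.
move=> fA fC AC; apply: EFin_inj; rewrite EFinD -!area_fin//.
  by rewrite measureU//; [case: fA|case: fC].
split; first by apply: measurableU; [case: fA|case: fC].
rewrite measureU//; [|by case: fA|by case: fC].
by rewrite lte_add_pinfty//; [case: fA|case: fC].
Qed.

Lemma finite_area_euclid_ball c r : 0 <= r -> finite_area (euclid_ball c r).
Proof.
by move=> r0; split; [exact: measurable_euclid_ball|exact: euclid_ball_lty].
Qed.

Lemma Rintegral_indic (D A : set (R * R)) (k : R) : measurable (D : set T) ->
  finite_area A ->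
  mu.-integrable (D : set T) (EFin \o (fun x => k * \1_A x)) /\
  \int[mu]_(x in (D : set T)) (k * \1_A x) = k * area (A `&` D).
Proof.
move=> mD [mA Af].
have iA : mu.-integrable (D : set T) (EFin \o (\1_A : T -> R)).
  apply/integrableP; split.
    by apply/measurable_EFinP; apply: measurable_funTS; exact: measurable_indic.
  rewrite (_ : \int[mu]_(x in D) _ = \int[mu]_(x in D) (\1_A x)%:E)%E.
    rewrite integral_indic//; apply: le_lt_trans Af; apply: le_measure => //;
      rewrite inE//; exact: measurableI.
  by apply: eq_integral => x _ /=; rewrite ger0_norm// indicE.
split.
  rewrite (_ : _ \o _ = fun x => (k%:E * (EFin \o (\1_A : T -> R)) x)%E).
    by apply: integrableZl.
  by apply/funext => x; rewrite /= EFinM.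
by rewrite RintegralZl// /Rintegral integral_indic.
Qed.

End area.

(** * Filling a ball *)

Section core.
Context {R : realType}.
Notation T := (lebesgue_plane R).
Notation mu := (lebesgue_measure2 R).

(** Convexity of the unit disc, applied to [(1 - h) (f, g) + h (p, q)]. The length of [(p, q)] is
    restricted only where [h] does not vanish, because the calibration [(x - c) / b] is longer than
    1 outside the closed ball of radius [b]. *)
Lemma test_field_interpolate (h f g p q : R * R -> R) :
  C1plane h -> bounded_support h -> (forall x, 0 <= h x <= 1) ->
  test_field f g -> C1plane p -> C1plane q ->
  (forall x, h x != 0 -> p x ^+ 2 + q x ^+ 2 <= 1) ->
  test_field (fun z => f z + (- (h z * f z) + h z * p z))
             (fun z => g z + (- (h z * g z) + h z * q z)).
Proof.
move=> Ch bh h01 [afg fg1] Cp Cq pq1.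
have [Cf Cg bf bg] := afg.
split.
  exact: (admissibleD afg (admissibleD (admissibleN (admissibleM Ch bh Cf Cg))
                                       (admissibleM Ch bh Cp Cq))).
move=> x; have [->|hx] := eqVneq (h x) 0; first by rewrite !mul0r oppr0 !addr0.
have := pq1 _ hx; have := fg1 x; have /andP[] := h01 x.
move: (h x) (f x) (g x) (p x) (q x) => k u v y z k0 k1 uv yz.
have h1 := sqr_ge0 (u - y); have h2 := sqr_ge0 (v - z).
have h3 : 0 <= k * (1 - k) by rewrite mulr_ge0// subr_ge0.
have -> : (u + (- (k * u) + k * y)) ^+ 2 + (v + (- (k * v) + k * z)) ^+ 2 =
  (1 - k) * (u ^+ 2 + v ^+ 2) + k * (y ^+ 2 + z ^+ 2)
  - k * (1 - k) * ((u - y) ^+ 2 + (v - z) ^+ 2) by ring.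
nra.
Qed.

(** [G] stands for the bulk term of an estimate and [C * \1_A] for the error carried by the annulus
    [A]. *)
Lemma flux_le_indic (D A : set T) (f g G : R * R -> R) (C : R) :
  measurable D -> finite_area A -> admissible f g ->
  mu.-integrable D (EFin \o G) ->
  (forall x, D x -> plane_div f g x <= G x + C * \1_A x) ->
  flux D f g <= \int[mu]_(x in D) G x + C * area (A `&` D).
Proof.
move=> mD fA afg iG H.
have [i1 <-] := Rintegral_indic C mD fA.
rewrite -(RintegralD mD iG i1) /flux.
have iGA := integrableD mD iG i1.
by apply: (le_Rintegral mD (plane_div_integrable mD afg) iGA).
Qed.

Lemma flux_interpolate (D : set T) (f g cf cg cp cq : R * R -> R) :
  measurable D -> admissible f g -> admissible cf cg -> admissible cp cq ->
  flux D (fun z => f z + (- cf z + cp z)) (fun z => g z + (- cg z + cq z)) =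
  flux D f g - flux D cf cg + flux D cp cq.
Proof.
move=> mD afg acf acp; have aN := admissibleN acf.
rewrite (fluxD mD afg (admissibleD aN acp)) (fluxD mD aN acp) (fluxN mD acf).
exact: addrA.
Qed.

Lemma plane_div_interpolate (f g cf cg cp cq : R * R -> R) (x : R * R) :
  admissible f g -> admissible cf cg -> admissible cp cq ->
  plane_div (fun z => f z + (- cf z + cp z)) (fun z => g z + (- cg z + cq z)) x =
  plane_div f g x - plane_div cf cg x + plane_div cp cq x.
Proof.
move=> [Cf Cg _ _] [Ccf Ccg _ _] [Ccp Ccq _ _].
have CNf := C1plane_opp Ccf; have CNg := C1plane_opp Ccg.
rewrite (plane_divD x Cf Cg (C1plane_add CNf Ccp) (C1plane_add CNg Ccq)).
rewrite (plane_divD x CNf CNg Ccp Ccq) /plane_div (D_opp _ _ Ccf) (D_opp _ _ Ccg).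
by rewrite opprD addrA.
Qed.

Lemma flux_le_in (D A : set T) (C : R) (f g cf cg cp cq G : R * R -> R) :
  measurable D -> finite_area A ->
  admissible f g -> admissible cf cg -> admissible cp cq ->
  mu.-integrable D (EFin \o G) ->
  (forall x, D x -> plane_div f g x - plane_div cf cg x
    + plane_div cp cq x <= G x + C * \1_A x) ->
  flux D f g - flux D cf cg + flux D cp cq <=
    \int[mu]_(x in D) G x + C * area (A `&` D).
Proof.
move=> mD fA afg acf acp iG H; rewrite -(flux_interpolate mD afg acf acp).
apply: (flux_le_indic mD fA _ iG) => [|x Dx].
  exact: (admissibleD afg (admissibleD (admissibleN acf) acp)).
by rewrite (plane_div_interpolate x afg acf acp); exact: H.
Qed.

Lemma flux_le_out (D A : set T) (C : R) (cf cg cp cq : R * R -> R) :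
  measurable D -> finite_area A -> admissible cf cg -> admissible cp cq ->
  (forall x, D x -> plane_div cp cq x - plane_div cf cg x <= C * \1_A x) ->
  flux D cp cq - flux D cf cg <= C * area (A `&` D).
Proof.
move=> mD fA acf acp H.
have aN := admissibleN acf.
have e1 := fluxD mD acp aN; have e2 := fluxN mD acf.
rewrite e2 in e1; rewrite -e1.
have i0 : mu.-integrable D (EFin \o (fun=> 0 : R)) by exact: integrable0.
have e0 : \int[mu]_(x in D) (fun=> 0 : R) x = 0 by rewrite Rintegral_cst// mul0r.
have := flux_le_indic mD fA (admissibleD acp aN) i0 (C := C).
rewrite e0 add0r; apply => x Dx; rewrite add0r.
case: acp => Ccp Ccq _ _; case: acf => Ccf Ccg _ _; case: aN => CNf CNg _ _.
apply: le_trans (H x Dx); rewrite (plane_divD x Ccp Ccq CNf CNg).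
by rewrite /plane_div (D_opp _ _ Ccf) (D_opp _ _ Ccg) opprD.
Qed.

(** Trades a flux through [S] for fluxes through two regions outside [S], one in the ball [D] and
    one beyond it, so that errors are measured by areas outside [S]. *)
Lemma flux_partition (S D : set T) (f g : R * R -> R) :
  measurable S -> measurable D -> admissible f g ->
  flux S f g = - (flux (D `\` S) f g + flux (~` S `\` D) f g).
Proof.
move=> mS mD afg.
have NE : ~` S = (D `\` S) `|` (~` S `\` D).
  apply/seteqP; split => x /=; last by move=> [[]|[]].
  by move=> Sx; have [?|?] := pselect (D x); [left|right].
have WN : (D `\` S) `&` (~` S `\` D) = set0.
  by apply/seteqP; split => x //= [[? ?] []].
have mW := measurableD mD mS; have mN := measurableD (measurableC mS) mD.
by rewrite -(flux_setU mW mN WN afg) -NE (flux_setC mS afg) opprK.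
Qed.

Let fill_arith (W1 W2 W3 N2 N3 s i x y P C : R) :
  W1 - W2 + W3 <= i + C * x -> N3 - N2 <= C * y ->
  s - - (W2 + N2) + - (W3 + N3) <= P -> s + W1 <= P + i + C * (x + y).
Proof. by move=> *; rewrite mulrDr; lra. Qed.

(* Here (cf, cg) = chi (f, g) and (cp, cq) = chi (p, q) for a cutoff chi: testing
   S against (1 - chi) (f, g) + chi (p, q) bounds the flux of (f, g) through
   S `|` D, because the flux of chi (p - f, q - g) through S is minus its flux
   through the complement of S. *)
Lemma flux_fill (S D A : set T) (P C : R) (f g cf cg cp cq G : R * R -> R) :
  measurable S -> measurable D -> finite_area A ->
  admissible f g -> admissible cf cg -> admissible cp cq ->
  flux S (fun z => f z + (- cf z + cp z)) (fun z => g z + (- cg z + cq z)) <= P ->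
  mu.-integrable (D `\` S) (EFin \o G) ->
  (forall x, (D `\` S) x -> plane_div f g x - plane_div cf cg x
    + plane_div cp cq x <= G x + C * \1_A x) ->
  (forall x, ~ D x -> plane_div cp cq x - plane_div cf cg x <= C * \1_A x) ->
  flux (S `|` D) f g <= P + \int[mu]_(x in D `\` S) G x + C * area (A `\` S).
Proof.
move=> mS mD fA afg acf acp + iG HW HN.
rewrite (flux_interpolate mS afg acf acp).
have mW := measurableD mD mS; have mN := measurableD (measurableC mS) mD.
rewrite (flux_partition mS mD acf) (flux_partition mS mD acp).
have boundW := flux_le_in mW fA afg acf acp iG HW.
have boundN := flux_le_out mN fA acf acp (fun x Nx => HN x Nx.2).
have SW : S `&` (D `\` S) = set0 by apply/seteqP; split => x //= [? []].
have SD : S `|` D = S `|` (D `\` S).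
  by apply/seteqP; split => x /=; have := pselect (S x); tauto.
have AS : area (A `\` S) = area (A `&` (D `\` S)) + area (A `&` (~` S `\` D)).
  have mA := fA.1.
  have f1 := finite_areaS (measurableI _ _ mA mW) (@subIsetl _ _ _) fA.
  have f2 := finite_areaS (measurableI _ _ mA mN) (@subIsetl _ _ _) fA.
  rewrite -(area_setU f1 f2); last by apply/seteqP; split => x //= [[? [? ?]] [? [? ?]]].
  by congr area; apply/seteqP; split => x /=; have := pselect (D x); tauto.
rewrite SD (flux_setU mS mW SW afg) AS; move: boundW boundN.
exact: fill_arith.
Qed.

End core.

Section fill.
Context {R : realType}.
Notation T := (lebesgue_plane R).
Notation mu := (lebesgue_measure2 R).

Lemma D1_cutoff (c x : R * R) (a b : R) : 
  'D_(1, 0) (cutoff c a b) x = - cutoff_weight c a b x * (x.1 - c.1).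
Proof. by rewrite D_cutoff/= mul1r mul0r addr0. Qed.

Lemma D2_cutoff (c x : R * R) (a b : R) : 
  'D_(0, 1) (cutoff c a b) x = - cutoff_weight c a b x * (x.2 - c.2).
Proof. by rewrite D_cutoff/= mul1r mul0r add0r. Qed.

Let gradient_arith (e w u v f g : R) :
  e + (- w * u * f + - w * v * g) = e - w * (u * f + v * g).
Proof. by ring. Qed.

Lemma plane_div_cutoff (c x : R * R) (a b : R) (f g : R * R -> R) :
  C1plane f -> C1plane g ->
  plane_div (fun z => cutoff c a b z * f z) (fun z => cutoff c a b z * g z) x =
  cutoff c a b x * plane_div f g x
  - cutoff_weight c a b x * ((x.1 - c.1) * f x + (x.2 - c.2) * g x).
Proof.
move=> Cf Cg; rewrite (plane_divM x (C1plane_cutoff c a b) Cf Cg).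
by rewrite D1_cutoff D2_cutoff; exact: gradient_arith.
Qed.

Variables (S : set (R * R)) (c : R * R) (a t b : R).
Hypotheses (mS : measurable (S : set T)) (a0 : 0 < a) (at_ : a <= t) (tb : t <= b)
  (ab : a < b).

Let ann := euclid_ball c b `\` euclid_ball c a.

Let t0 : 0 <= t. Proof. exact: le_trans (ltW a0) at_. Qed.
Let b0 : 0 <= b. Proof. exact: le_trans t0 tb. Qed.

(** The three regimes of the cutoff. The annulus case leaves membership in the ball of radius [t]
    open, as its boundary circle lies in the closed annulus. *)
Lemma annulusP x :
  [\/ [/\ euclid_ball c t x, sqdist c x <= a ^+ 2 & \1_ann x = 0 :> R],
      [/\ ~ euclid_ball c t x, b ^+ 2 <= sqdist c x & \1_ann x = 0 :> R] |
      [/\ a ^+ 2 <= sqdist c x, sqdist c x < b ^+ 2 & \1_ann x = 1 :> R]].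
Proof.
rewrite indicE.
have Bt : euclid_ball c t x <-> sqdist c x < t ^+ 2 by rewrite euclid_ballE.
have Ba : euclid_ball c a x <-> sqdist c x < a ^+ 2 by rewrite euclid_ballE// ltW.
have Bb : euclid_ball c b x <-> sqdist c x < b ^+ 2 by rewrite euclid_ballE.
have at2 : a ^+ 2 <= t ^+ 2 by rewrite ler_pXn2r// nnegrE ltW.
have tb2 : t ^+ 2 <= b ^+ 2 by rewrite ler_pXn2r// nnegrE.
have [xa|xa] := ltP (sqdist c x) (a ^+ 2).
  rewrite memNset; last by move=> [_]; apply; exact/Ba.
  by apply: Or31; split => //; [apply/Bt; exact: lt_le_trans at2|exact: ltW].
have [xb|xb] := ltP (sqdist c x) (b ^+ 2).
  rewrite mem_set; first exact: Or33.
  by split; [exact/Bb|move/Ba; rewrite ltNge xa].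
rewrite memNset; last by move=> [/Bb]; rewrite ltNge xb.
apply: Or32; split => //; move/Bt.
by rewrite ltNge (le_trans tb2).
Qed.

Lemma area_annulusD (r s : R) (X : set (R * R)) : 0 <= r -> r <= s ->
  measurable (X : set T) ->
  area (euclid_ball c s `\` X) - area (euclid_ball c r `\` X) =
  area ((euclid_ball c s `\` euclid_ball c r) `\` X).
Proof.
move=> r0 rs mX; have s0 := le_trans r0 rs.
have fs := finite_area_euclid_ball c s0; have fr := finite_area_euclid_ball c r0.
have mr := measurableD fr.1 mX.
have msr := measurableD (measurableD fs.1 fr.1) mX.
have f1 := finite_areaS mr (@subDsetl _ _ _) fr.
have f2 := finite_areaS msr (subset_trans (@subDsetl _ _ _) (@subDsetl _ _ _)) fs.
have -> : euclid_ball c s `\` X =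
  (euclid_ball c r `\` X) `|` ((euclid_ball c s `\` euclid_ball c r) `\` X).
  apply/seteqP; split => x /=.
    by have := pselect (euclid_ball c r x); tauto.
  by have := @euclid_ballS _ c _ _ rs x; rewrite /=; tauto.
rewrite (area_setU f1 f2); first by rewrite addrAC subrr add0r.
by apply/seteqP; split => x //= [[? ?] [[? ?] ?]].
Qed.


Let arith_ball (k w df dp u v f g p q m M L : R) :
  0 <= k -> k <= 1 -> `|df| <= m -> `|dp| <= M ->
  `|- w * u * f + - w * v * g| <= L -> `|- w * u * p + - w * v * q| <= L ->
  df - (k * df - w * (u * f + v * g)) + (k * dp - w * (u * p + v * q)) <=
  dp + (m + M + 2 * L).
Proof.
by move=> k0 k1 /ler_normlP[? ?] /ler_normlP[? ?] /ler_normlP[? ?] /ler_normlP[? ?]; nra.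
Qed.

Let arith_out (k w df dp u v f g p q m M L : R) :
  0 <= k -> k <= 1 -> `|df| <= m -> `|dp| <= M ->
  `|- w * u * f + - w * v * g| <= L -> `|- w * u * p + - w * v * q| <= L ->
  (k * dp - w * (u * p + v * q)) - (k * df - w * (u * f + v * g)) <=
  m + M + 2 * L.
Proof.
by move=> k0 k1 /ler_normlP[? ?] /ler_normlP[? ?] /ler_normlP[? ?] /ler_normlP[? ?]; nra.
Qed.

Let fann : finite_area ann.
Proof.
have fb := finite_area_euclid_ball c b0.
apply: (finite_areaS _ (@subDsetl _ _ _) fb); apply: measurableD; first exact: fb.1.
exact/measurable_euclid_ball/ltW.
Qed.

(** The two fields are unrelated, so each of them pays the full cutoff gradient [4 / (b - a)] on the
    annulus. The resulting error is of the order of a difference quotient of the area outside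
    [S]. *)
Lemma flux_fill_flux (P m M : R) (f g p q : R * R -> R) :
  (forall f g, test_field f g -> flux S f g <= P) ->
  test_field f g -> test_field p q ->
  (forall x, `|plane_div f g x| <= m) -> (forall x, `|plane_div p q x| <= M) ->
  flux (S `|` euclid_ball c t) f g <= P + flux (euclid_ball c t `\` S) p q +
    (m + M + 2 * (4 / (b - a))) * area (ann `\` S).
Proof.
move=> HP tfg tpq Hm HM.
have [afg fg1] := tfg; have [apq pq1] := tpq.
have [Cf Cg _ _] := afg; have [Cp Cq _ _] := apq.
have mt : measurable (euclid_ball c t : set T) by exact: measurable_euclid_ball.
have Cchi := C1plane_cutoff c a b; have bchi := bounded_support_cutoff c a0 ab.
have chi01 x : 0 <= cutoff c a b x <= 1 by rewrite cutoff_ge0 cutoff_le1.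
have grad f' g' x := @cutoff_gradient_le _ c a b a0 ab f' g' x.
apply: (flux_fill mS mt fann afg (admissibleM Cchi bchi Cf Cg)
                  (admissibleM Cchi bchi Cp Cq)).
- by apply: HP; exact: test_field_interpolate.
- by apply: plane_div_integrable => //; exact: measurableD.
- move=> x [xt _]; rewrite (plane_div_cutoff c x a b Cf Cg) (plane_div_cutoff c x a b Cp Cq).
  case: (annulusP x) => [[_ xa ->]|[nxt _ _]|[xa xb ->]].
  + rewrite cutoff_in// cutoff_weight_in// !mul1r !mul0r !subr0 subrr add0r mulr0.
    by rewrite addr0.
  + by [].
  + rewrite mulr1; have /andP[k0 k1] := chi01 x.
    have := grad _ _ x (fg1 x); have := grad _ _ x (pq1 x); rewrite D1_cutoff D2_cutoff.
    by move=> h1 h2; apply: arith_ball.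
- move=> x nxt; rewrite (plane_div_cutoff c x a b Cf Cg) (plane_div_cutoff c x a b Cp Cq).
  case: (annulusP x) => [[xt _ _]|[_ xb ->]|[xa xb ->]].
  + by [].
  + by rewrite cutoff_out// cutoff_weight_out// !mul0r !subr0 mulr0.
  + rewrite mulr1; have /andP[k0 k1] := chi01 x.
    have := grad _ _ x (fg1 x); have := grad _ _ x (pq1 x); rewrite D1_cutoff D2_cutoff.
    by move=> h1 h2; apply: arith_out.
Qed.

(** On the annulus the radial product [u * f + v * g] of a field of length at most 1 exceeds that of
    the calibration by at most [(b ^+ 2 - a ^+ 2) / (2 * b)]. This cancels the denominator of the
    weight [w], so the error stays bounded as the annulus shrinks. The bound is one-sided, and its
    sign is the one that occurs both inside and outside the ball of radius [t]. *)
Let arith_cauchy (w u v f g z : R) : 0 <= w -> 0 < b ->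
  f ^+ 2 + g ^+ 2 <= 1 -> z = b^-1 ->
  a ^+ 2 <= u ^+ 2 + v ^+ 2 -> w * (b ^+ 2 - a ^+ 2) <= 4 ->
  w * (u * f + v * g) - w * (u * (z * u) + v * (z * v)) <= 2 * z.
Proof.
move=> w0 b_gt0 fg zE s2 wl.
have bz : b * z = 1 by rewrite zE divff ?gt_eqF.
have z0 : 0 < z by rewrite zE invr_gt0.
have h1 : u * f + v * g <= (z * (u ^+ 2 + v ^+ 2) + b * (f ^+ 2 + g ^+ 2)) / 2.
  have e : z * (u ^+ 2 + v ^+ 2) + b * (f ^+ 2 + g ^+ 2) - 2 * (u * f + v * g) =
    z * ((u - b * f) ^+ 2 + (v - b * g) ^+ 2).
    rewrite (_ : z * ((u - b * f) ^+ 2 + (v - b * g) ^+ 2) =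
      z * (u ^+ 2 + v ^+ 2) + (b * z) * (b * (f ^+ 2 + g ^+ 2))
      - 2 * (b * z) * (u * f + v * g)); last by ring.
    by rewrite bz; ring.
  have : 0 <= z * ((u - b * f) ^+ 2 + (v - b * g) ^+ 2).
    by apply: mulr_ge0; [exact: ltW|apply: addr_ge0; exact: sqr_ge0].
  by rewrite -e; lra.
have h2 : b * (f ^+ 2 + g ^+ 2) <= b by rewrite ger_pMr.
have h3 : u * f + v * g - z * (u ^+ 2 + v ^+ 2) <= z * (b ^+ 2 - a ^+ 2) / 2.
  have -> : z * (b ^+ 2 - a ^+ 2) = b - z * a ^+ 2.
    by rewrite mulrBr expr2 mulrA (mulrC z) bz mul1r.
  have : z * a ^+ 2 <= z * (u ^+ 2 + v ^+ 2) by rewrite ler_pM2l.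
  by lra.
have -> : w * (u * f + v * g) - w * (u * (z * u) + v * (z * v)) =
  w * (u * f + v * g - z * (u ^+ 2 + v ^+ 2)) by ring.
apply: le_trans (ler_wpM2l w0 h3) _.
have -> : w * (z * (b ^+ 2 - a ^+ 2) / 2) = z * (w * (b ^+ 2 - a ^+ 2)) / 2 by ring.
have : z * (w * (b ^+ 2 - a ^+ 2)) <= z * 4 by rewrite ler_pM2l.
by lra.
Qed.

Let arith_in1 (k df z m X Y : R) : 0 <= k -> k <= 1 -> 0 <= z -> `|df| <= m ->
  X - Y <= 2 * z -> df - (k * df - X) + (k * (2 * z) - Y) <= 2 * z + (m + 4 * z).
Proof. by move=> k0 k1 z0 /ler_normlP[? ?] ?; nra. Qed.

Let arith_out1 (k df z m X Y : R) : 0 <= k -> k <= 1 -> 0 <= z -> `|df| <= m ->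
  X - Y <= 2 * z -> k * (2 * z) - Y - (k * df - X) <= m + 4 * z.
Proof. by move=> k0 k1 z0 /ler_normlP[? ?] ?; nra. Qed.

(* The comparison field (x - c) / b is the calibration of the ball B_b. *)
Lemma flux_fill_curvature (P m : R) (f g : R * R -> R) :
  (forall f g, test_field f g -> flux S f g <= P) ->
  test_field f g -> (forall x, `|plane_div f g x| <= m) ->
  flux (S `|` euclid_ball c t) f g <=
    P + 2 / b * area (euclid_ball c t `\` S) + (m + 4 / b) * area (ann `\` S).
Proof.
move=> HP tfg Hm.
have [afg fg1] := tfg.
have [Cf Cg _ _] := afg.
have b_gt0 : 0 < b by exact: lt_trans ab.
pose z := b^-1; have z0 : 0 <= z by rewrite invr_ge0 ltW.
pose p (x : R * R) := z * (x.1 - c.1); pose q (x : R * R) := z * (x.2 - c.2).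
have C1 : C1plane (fun x : R * R => x.1 - c.1).
  by apply: C1plane_add; [exact: C1plane_fst|exact: C1plane_cst].
have C2 : C1plane (fun x : R * R => x.2 - c.2).
  by apply: C1plane_add; [exact: C1plane_snd|exact: C1plane_cst].
have Cp : C1plane p by exact: (C1plane_mul (C1plane_cst z) C1).
have Cq : C1plane q by exact: (C1plane_mul (C1plane_cst z) C2).
have divpq x : plane_div p q x = 2 * z.
  rewrite /plane_div (D_mul _ _ (C1plane_cst z) C1) (D_mul _ _ (C1plane_cst z) C2).
  rewrite !D_cst (D_add _ _ C1plane_fst (C1plane_cst _)).
  rewrite (D_add _ _ C1plane_snd (C1plane_cst _)) !D_cst D_fst D_snd/=.
  by rewrite !mul0r !add0r !addr0 mulr1 mulr_natl.
have pq1 x : sqdist c x < b ^+ 2 -> p x ^+ 2 + q x ^+ 2 <= 1.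
  move=> xb; rewrite /p /q !exprMn -mulrDr /z exprVn mulrC ler_pdivrMr ?exprn_gt0//.
  by rewrite mul1r ltW.
have mt : measurable (euclid_ball c t : set T) by exact: measurable_euclid_ball.
have mW := measurableD mt mS.
have ft := finite_area_euclid_ball c t0.
have Cchi := C1plane_cutoff c a b; have bchi := bounded_support_cutoff c a0 ab.
have chi01 x : 0 <= cutoff c a b x <= 1 by rewrite cutoff_ge0 cutoff_le1.
pose G x : R := 2 / b * \1_(euclid_ball c t) x.
have [iG eG] := Rintegral_indic (2 / b) mW ft.
have -> : 2 / b * area (euclid_ball c t `\` S) = 
    \int[mu]_(x in euclid_ball c t `\` S) G x.
  by rewrite eG; congr (_ * area _); apply/seteqP; split => x //= [].
apply: (flux_fill mS mt fann afg (admissibleM Cchi bchi Cf Cg)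
                  (admissibleM Cchi bchi Cp Cq)).
- apply: HP; apply: test_field_interpolate => // x hx; apply: pq1.
  by rewrite ltNge; apply: contra hx => xb; rewrite cutoff_out.
- exact: iG.
- move=> x [xt _].
  rewrite (plane_div_cutoff c x a b Cf Cg) (plane_div_cutoff c x a b Cp Cq) divpq.
  rewrite /G indicE mem_set// mulr1.
  case: (annulusP x) => [[_ xa ->]|[nxt _ _]|[xa xb ->]].
  + rewrite (cutoff_in a0 ab xa) (cutoff_weight_in a0 ab xa).
    by rewrite !mul1r !mul0r !subr0 subrr add0r mulr0 addr0.
  + by [].
  + rewrite mulr1; have /andP[k0 k1] := chi01 x.
    apply: arith_in1 => //; apply: arith_cauchy => //.
    * exact: cutoff_weight_ge0.
    * exact: cutoff_weight_le4.
- move=> x nxt.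
  rewrite (plane_div_cutoff c x a b Cf Cg) (plane_div_cutoff c x a b Cp Cq) divpq.
  case: (annulusP x) => [[xt _ _]|[_ xb ->]|[xa xb ->]].
  + by [].
  + by rewrite (cutoff_out a0 ab xb) (cutoff_weight_out a0 ab xb) !mul0r !subr0 mulr0.
  + rewrite mulr1; have /andP[k0 k1] := chi01 x.
    apply: arith_out1 => //; apply: arith_cauchy => //.
    * exact: cutoff_weight_ge0.
    * exact: cutoff_weight_le4.
Qed.

End fill.

(** * The limit of thin annuli *)

Section fill_limit.
Context {R : realType}.
Notation T := (lebesgue_plane R).
Notation mu := (lebesgue_measure2 R).

Lemma ler_linear_eps (x y K : R) : (forall e, 0 < e -> x <= y + K * e) -> x <= y.
Proof.
move=> H; apply/ler_addgt0Pr => e e0.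
have K0 : 0 < `|K| + 1 by rewrite ltr_pwDr.
apply: le_trans (H (e / (`|K| + 1)) _) _; first by rewrite divr_gt0.
rewrite lerD2l mulrA ler_pdivrMr// mulrC ler_pM2l//.
by rewrite (le_trans (ler_norm K))// lerDl.
Qed.

Let arith_curv (P iv it V C C' s k e q F : R) : 0 <= V -> 0 <= s ->
  iv <= it -> C <= C' -> 0 <= C' -> 0 < k -> k * s <= e * q ->
  F <= P + 2 * iv * V + C * s -> F <= P + 2 * it * V + (C' * (q / k)) * e.
Proof.
move=> V0 s0 ivt CC C0 k0 ks /le_trans; apply; rewrite -!addrA lerD2l.
apply: lerD; first by rewrite ler_wpM2r// ler_wpM2l.
apply: (@le_trans _ _ (C' * s)); first by rewrite ler_wpM2r.
by rewrite -mulrA ler_wpM2l// mulrAC ler_pdivlMr// mulrC (mulrC q).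
Qed.

Let arith_flux (P W m d s k e q F : R) : 0 <= m -> 0 < d -> 0 < k ->
  s <= d * q -> k * s <= e * q ->
  F <= P + W + (m + 2 * (4 / d)) * s -> F <= P + W + 8 * q + (m * (q / k)) * e.
Proof.
move=> m0 d0 k0 sd ks /le_trans; apply; rewrite -!addrA !lerD2l mulrDl addrC.
apply: lerD; last first.
  rewrite (_ : 2 * (4 / d) * s = 8 * (s / d)); last by ring.
  by rewrite ler_pM2l// ler_pdivrMr// mulrC.
by rewrite -mulrA ler_wpM2l// mulrAC ler_pdivlMr// mulrC (mulrC q).
Qed.

Let arith_move (F P W q K : R) : F <= P + - W + q + K -> F + W <= P + q + K.
Proof. by lra. Qed.

(** The bisected function combines the area outside [S] with [kappa] times the area of the ball. Its
    slope bound gives thin annuli around [t] whose area outside [S] is at most [(v - u) * q], which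
    pays for the cutoff gradient of order [1 / (v - u)], and tends to 0, which removes the terms in
    the divergence bounds [m] and [M]. The 8 is twice the 4 of [cutoff_gradient_le]. *)
Lemma fill_ball_estimates (S : set (R * R)) (c : R * R) (P a b kappa q : R) :
  measurable (S : set T) -> 0 < a -> a < b -> 0 < kappa ->
  (forall f g, test_field f g -> flux S f g <= P) ->
  (area (euclid_ball c b `\` S) + kappa * area (euclid_ball c b)) -
  (area (euclid_ball c a `\` S) + kappa * area (euclid_ball c a)) <= (b - a) * q ->
  exists t, [/\ a <= t, t <= b,
    forall f g, test_field f g -> flux (S `|` euclid_ball c t) f g <=
      P + 2 / t * area (euclid_ball c t `\` S) &
    forall f g f' g', test_field f g -> test_field f' g' ->
      flux (S `|` euclid_ball c t) f g + flux (euclid_ball c t `\` S) f' g' <=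
      P + 8 * q].
Proof.
move=> mS a0 ab k0 HP /(@bisection_slope _ (fun r => area (euclid_ball c r `\` S) +
  kappa * area (euclid_ball c r)) _ _ _ ab)[t [/andP[at_ tb] Ht]].
have t0 : 0 < t by exact: lt_le_trans at_.
have mt := measurable_euclid_ball c (ltW t0).
have {}Ht e : 0 < e -> exists u v,
    [/\ [/\ 0 < u, u <= t, t <= v, u < v & a <= u],
        area ((euclid_ball c v `\` euclid_ball c u) `\` S) <= (v - u) * q &
        kappa * area ((euclid_ball c v `\` euclid_ball c u) `\` S) <= e * q].
  move=> e0; have [u [v [[au ut tv vb] [uv vue]]]] := Ht _ e0.
  have u0 := lt_le_trans a0 au; have v0 := lt_trans u0 uv.
  set s := area _; set s' := area _; set r := area _; set r' := area _ => slope.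
  have es : s - r = area ((euclid_ball c v `\` euclid_ball c u) `\` S).
    by rewrite /s /r (area_annulusD c (ltW u0) (ltW uv) mS).
  have er : s' - r' = area (euclid_ball c v `\` euclid_ball c u).
    have := area_annulusD c (ltW u0) (ltW uv) (@measurable0 _ T).
    by rewrite !setD0.
  have fv := finite_area_euclid_ball c (ltW v0).
  have mvu := measurableD fv.1 (measurable_euclid_ball c (ltW u0)).
  have fvu := finite_areaS mvu (@subDsetl _ _ _) fv.
  have le_sr : s - r <= s' - r'.
    rewrite es er; apply: area_le fvu; last exact: subDsetl.
    exact: measurableD.
  have sr0 : 0 <= s - r by rewrite es area_ge0.
  exists u, v; split=> //; rewrite -es; clear - slope le_sr sr0 vue k0 uv e0.
    have : 0 <= kappa * (s' - r') by exact: (mulr_ge0 (ltW k0) (le_trans sr0 le_sr)).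
    by rewrite mulrBr; move: slope; lra.
  have h1 : kappa * (s - r) <= kappa * (s' - r') by rewrite ler_pM2l.
  have h2 : kappa * (s' - r') <= (v - u) * q.
    by rewrite mulrBr; move: slope sr0; lra.
  have q0 : 0 <= q.
    rewrite -(@pmulr_rge0 _ (v - u)) ?subr_gt0//.
    by apply: le_trans h2; exact: (mulr_ge0 (ltW k0) (le_trans sr0 le_sr)).
  by apply: le_trans h1 (le_trans h2 _); rewrite ler_wpM2r// ltW.
exists t; split => //.
- move=> f g tfg; have [m [m0 Hm]] := plane_div_bounded tfg.1.
  apply: (@ler_linear_eps _ _ ((m + 4 / a) * (q / kappa))) => e e0.
  have [u [v [[u0 ut tv uv au] _ s2]]] := Ht e e0.
  have := @flux_fill_curvature _ S c u t v mS u0 ut tv uv P m f g HP tfg Hm.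
  have a4 : 0 <= 4 / a by rewrite divr_ge0// ltW.
  apply: arith_curv => //.
  + exact: area_ge0.
  + exact: area_ge0.
  + by rewrite lef_pV2// posrE (lt_le_trans t0).
  + rewrite lerD2l ler_pM2l// lef_pV2// ?posrE ?(lt_trans u0)//.
    by rewrite (le_trans au) // ltW.
  + exact: addr_ge0.
(* The comparison field is the opposite of [(f', g')], so that its flux moves to the left-hand side
   as a second perimeter. *)
- move=> f g f' g' tfg tfg'; have tN := test_fieldN tfg'.
  have [m [m0 Hm]] := plane_div_bounded tfg.1.
  have [M [M0 HM]] := plane_div_bounded tN.1.
  apply: (@ler_linear_eps _ _ ((m + M) * (q / kappa))) => e e0.
  have [u [v [[u0 ut tv uv au] s1 s2]]] := Ht e e0.
  have := @flux_fill_flux _ S c u t v mS u0 ut tv uv P m M f g _ _ HP tfg tN Hm HM.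
  have mM : 0 <= m + M by exact: addr_ge0.
  have vu : 0 < v - u by rewrite subr_gt0.
  move=> /(arith_flux mM vu k0 s1 s2).
  rewrite (fluxN (measurableD mt mS) tfg'.1).
  exact: arith_move.
Qed.

End fill_limit.

(** * Approximation of measurable sets by smooth functions *)

Section tensor.
Context {R : realType}.
Notation leb := (@lebesgue_measure R).
Implicit Types (a b : R -> R) (f g F : R * R -> R).

(* Unlike general C1 functions, these sums of products have C1 primitives in each
   variable without differentiation under the integral sign. *)
Inductive tensor : (R * R -> R) -> Prop :=
| tensor_mul a b : C1line a -> C1line b -> tensor (fun z => a z.1 * b z.2)
| tensor_add f g : tensor f -> tensor g -> tensor (fun z => f z + g z).

Lemma C1line_cst (k : R) : C1line (fun=> k).
Proof.
split=> [x|]; first exact: derivable_cst.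
rewrite (_ : derive1 _ = fun=> 0); first by move=> x; exact: cvg_cst.
by apply/funext => x; rewrite derive1E derive_cst.
Qed.

Lemma C1line_mul a b : C1line a -> C1line b -> C1line (fun x => a x * b x).
Proof.
move=> Ca Cb; split=> [x|]; first by apply: derivableM; [exact: Ca.1|exact: Cb.1].
rewrite (_ : derive1 _ = fun x => a x * derive1 b x + b x * derive1 a x).
  move=> x; apply: cvgD; apply: cvgM;
   [exact: C1line_continuous|exact: Cb.2|exact: C1line_continuous|exact: Ca.2].
apply/funext => x; rewrite !derive1E (deriveM (Ca.1 x) (Cb.1 x)).
by [].
Qed.

Lemma C1line_affine a (k l : R) : C1line a -> C1line (fun x => a (k * x + l)).
Proof.
move=> Ca.
have D (x : R) : is_derive x (1 : R) (fun x => k * x + l) k.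
  by apply: is_derive_eq; rewrite addr0 /GRing.scale/= mulr1.
have Da x : is_derive x (1 : R) (fun x => a (k * x + l)) (derive1 a (k * x + l) * k).
  apply: (@is_derive1_comp _ a (fun x => k * x + l)).
  by split; [exact: Ca.1|rewrite derive1E].
split=> [x|]; first by have [] := Da x.
rewrite (_ : derive1 _ = fun x => derive1 a (k * x + l) * k).
  move=> x; apply: cvgM; last exact: cvg_cst.
  apply: (@continuous_comp _ _ _ (fun x => k * x + l) (derive1 a)); last exact: Ca.2.
  by apply: cvgD; [apply: cvgM; [exact: cvg_cst|exact: cvg_id]|exact: cvg_cst].
by apply/funext => x; rewrite derive1E; have [] := Da x.
Qed.

Lemma tensor_C1plane f : tensor f -> C1plane f.
Proof.
elim=> [a b Ca Cb|{}f g _ Cf _ Cg]; last exact: C1plane_add.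
exact: (C1plane_mul (C1plane_comp Ca C1plane_fst) (C1plane_comp Cb C1plane_snd)).
Qed.

Lemma tensor_prod f g : tensor f -> tensor g -> tensor (fun z => f z * g z).
Proof.
move=> tf tg; elim: tf => [a b Ca Cb|f1 f2 _ t1 _ t2].
  elim: tg => [a' b' Ca' Cb'|g1 g2 _ t1 _ t2].
    rewrite (_ : (fun _ => _) = fun z => (a z.1 * a' z.1) * (b z.2 * b' z.2)).
      by apply: (@tensor_mul (fun x => a x * a' x) (fun x => b x * b' x));
         exact: C1line_mul.
    by apply/funext => z; rewrite mulrACA.
  rewrite (_ : (fun _ => _) =
    fun z => a z.1 * b z.2 * g1 z + a z.1 * b z.2 * g2 z); first exact: tensor_add.
  by apply/funext => z; rewrite mulrDr.
rewrite (_ : (fun _ => _) = fun z => f1 z * g z + f2 z * g z).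
  exact: tensor_add.
by apply/funext => z; rewrite mulrDl.
Qed.

Lemma tensor_fst a : C1line a -> tensor (fun z => a z.1).
Proof.
move=> Ca; rewrite (_ : (fun _ => _) = fun z => a z.1 * 1).
  exact: (tensor_mul Ca (C1line_cst 1)).
by apply/funext => z; rewrite mulr1.
Qed.

Lemma tensor_snd b : C1line b -> tensor (fun z => b z.2).
Proof.
move=> Cb; rewrite (_ : (fun _ => _) = fun z => 1 * b z.2).
  exact: (tensor_mul (C1line_cst 1) Cb).
by apply/funext => z; rewrite mul1r.
Qed.

Lemma tensor_cst (k : R) : tensor (fun=> k).
Proof. exact: (tensor_fst (C1line_cst k)). Qed.

Lemma tensor_scale (k : R) f : tensor f -> tensor (fun z => k * f z).
Proof. exact: (tensor_prod (tensor_cst k)). Qed.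

Lemma tensor_sub f g : tensor f -> tensor g -> tensor (fun z => f z - g z).
Proof.
move=> tf tg; rewrite (_ : (fun _ => _) = fun z => f z + (-1) * g z).
  exact: (tensor_add tf (tensor_scale (-1) tg)).
by apply/funext => z; rewrite mulN1r.
Qed.

Lemma tensor_swap f : tensor f -> tensor (fun z => f (z.2, z.1)).
Proof.
elim=> [a b Ca Cb|{}f g _ tf _ tg]; last exact: tensor_add.
rewrite (_ : (fun _ => _) = fun z => b z.1 * a z.2); first exact: tensor_mul.
by apply/funext => z /=; rewrite mulrC.
Qed.

Lemma tensor_shift (s : R) f : tensor f -> tensor (fun z => f (z.1 - s, z.2)).
Proof.
elim=> [a b Ca Cb|{}f g _ tf _ tg]; last exact: tensor_add.
have Cas : C1line (fun x => a (x - s)).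
  have := C1line_affine 1 (- s) Ca; congr C1line.
  by apply/funext => x; rewrite mul1r.
exact: (tensor_mul Cas Cb).
Qed.

Lemma tensor_primitive f : tensor f -> exists F, tensor F /\ forall z, 'D_(1, 0) F z = f z.
Proof.
elim=> [a b Ca Cb|{}f g _ [F [tF DF]] _ [G [tG DG]]].
  have [A [dA DA]] := primitive_continuous (C1line_continuous Ca).
  have CA : C1line A by split; [exact: dA|rewrite DA; exact: C1line_continuous].
  exists (fun z => A z.1 * b z.2); split; first exact: tensor_mul.
  move=> z.
  rewrite (D_mul _ _ (C1plane_comp CA C1plane_fst) (C1plane_comp Cb C1plane_snd)).
  rewrite (D_comp _ _ CA C1plane_fst) (D_comp _ _ Cb C1plane_snd) D_fst D_snd/=.
  by rewrite mulr1 !mulr0 addr0 DA.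
exists (fun z => F z + G z); split; first exact: tensor_add.
move=> z.
by rewrite (D_add _ _ (tensor_C1plane tF) (tensor_C1plane tG)) DF DG.
Qed.

Lemma D1_shift (s : R) f z :
  'D_(1, 0) (fun z => f (z.1 - s, z.2)) z = 'D_(1, 0) f (z.1 - s, z.2).
Proof.
rewrite /derive.
rewrite (_ : (fun h : R => h^-1 *: (f ((h *: (1, 0) + z).1 - s, (h *: (1, 0) + z).2)
   - f (z.1 - s, z.2))) =
  fun h => h^-1 *: (f (h *: (1, 0) + (z.1 - s, z.2)) - f (z.1 - s, z.2)))//.
apply/funext => h; congr (_ *: (f _ - _)).
by congr (_, _); rewrite /= addrA.
Qed.

Lemma slice_MVT F (y x1 x2 : R) : C1plane F -> x1 <= x2 -> exists2 xi,
  x1 <= xi <= x2 & F (x2, y) - F (x1, y) = 'D_(1, 0) F (xi, y) * (x2 - x1).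
Proof.
move=> CF x12; have CFy := C1line_slice1 y CF.
have [] := @MVT_segment _ (fun x => F (x, y)) (fun x => 'D_(1, 0) F (x, y)) x1 x2 x12.
- move=> x _; rewrite -derive1_slice1 derive1E.
  by split => //; exact: CFy.1.
- by apply: continuous_subspaceT; exact: C1line_continuous.
- by move=> xi; rewrite in_itv/= => x12i eF; exists xi.
Qed.

(** Let [G] be a primitive of [g] in the first variable and [H] one of [G]. Then [h] is a difference
    quotient of [G], and [psi] is [G] minus its moving average, itself a difference quotient of [H];
    both are thus tensors. As [g] has values in [0, 1], [G] is 1-Lipschitz in that variable, which
    bounds [psi] by [rho]. *)
Lemma tensor_average (rho : R) g : 0 < rho -> tensor g ->
  (forall z, 0 <= g z <= 1) -> exists h psi,
  [/\ tensor h /\ (forall z, 0 <= h z <= 1), tensor psi,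
      forall z, `|psi z| <= rho,
      forall z, 'D_(1, 0) psi z = g z - h z &
      forall x y, (\int[leb]_(t in `[(x - rho)%R, x]) (g (t, y))%:E =
                   (rho * h (x, y))%:E)%E].
Proof.
move=> rho0 tg g01.
have [G [tG DG]] := tensor_primitive tg.
have [H [tH DH]] := tensor_primitive tG.
have CG := tensor_C1plane tG; have CH := tensor_C1plane tH.
have tHs := tensor_scale rho^-1 (tensor_sub tH (tensor_shift rho tH)).
have tGs := tensor_scale rho^-1 (tensor_sub tG (tensor_shift rho tG)).
have xr x : x - rho <= x by rewrite gerBl ltW.
have e x : x - (x - rho) = rho by rewrite opprB addrC subrK.
exists (fun z => rho^-1 * (G z - G (z.1 - rho, z.2))).
exists (fun z => G z - rho^-1 * (H z - H (z.1 - rho, z.2))).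
split.
- split=> // -[x y] /=.
  have [xi _ ->] := slice_MVT y CG (xr x).
  by rewrite e DG mulrC mulfK ?gt_eqF.
- exact: tensor_sub.
- move=> [x y] /=.
  have [xi /andP[xi1 xi2] ->] := slice_MVT y CH (xr x).
  rewrite e DH mulrC mulfK ?gt_eqF//.
  have [eta _ ->] := slice_MVT y CG xi2.
  rewrite DG normrM -[leRHS]mul1r; apply: ler_pM => //.
    by have /andP[? ?] := g01 (eta, y); rewrite ger0_norm.
  by rewrite ger0_norm ?subr_ge0// lerBlDr addrC -lerBlDr.
- move=> z.
  have CHs := tensor_C1plane (tensor_shift rho tH).
  have Cm : C1plane (fun z => - (rho^-1 * (H z - H (z.1 - rho, z.2)))).
    by apply: C1plane_opp; exact: tensor_C1plane.
  rewrite (D_add _ _ CG Cm) (D_opp _ _ (tensor_C1plane tHs)).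
  rewrite (D_mul _ _ (C1plane_cst _) (tensor_C1plane (tensor_sub tH (tensor_shift rho tH)))).
  rewrite D_cst mul0r add0r (D_add _ _ CH (C1plane_opp CHs)) (D_opp _ _ CHs).
  by rewrite D1_shift DG !DH.
- move=> x y.
  have xr' : x - rho < x by rewrite gtrBl.
  have := derive1_FTC2 xr' (C1line_slice1 y CG).
  rewrite (_ : (fun t => _) = (fun t => (g (t, y))%:E)); last first.
    by apply/funext => t; rewrite derive1_slice1 DG.
  by move=> ->; rewrite mulrA divff ?mul1r// gt_eqF.
Qed.

End tensor.

(** * Sets approximable in L1 form a sigma-algebra *)

Section l1_approximation.
Context d (T : measurableType d) (R : realType) (mu : {measure set T -> \bar R}).
Variable D : set T.
Hypotheses (mD : measurable D) (fD : (mu D < +oo)%E).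
Implicit Types (u v g h : T -> R) (A C : set T).

Definition l1dist u v : \bar R := (\int[mu]_(x in D) (`|u x - v x|)%:E)%E.

Let mdist u v : measurable_fun setT u -> measurable_fun setT v ->
  measurable_fun D (fun x => (`|u x - v x|)%:E).
Proof.
move=> mu_ mv; apply/measurable_EFinP; apply: measurable_funTS.
by apply: measurableT_comp => //; exact: measurable_funB.
Qed.

Lemma l1dist_le u v u1 v1 u2 v2 :
  measurable_fun setT u -> measurable_fun setT v ->
  measurable_fun setT u1 -> measurable_fun setT v1 ->
  measurable_fun setT u2 -> measurable_fun setT v2 ->
  (forall x, `|u x - v x| <= `|u1 x - v1 x| + `|u2 x - v2 x|) ->
  (l1dist u v <= l1dist u1 v1 + l1dist u2 v2)%E.
Proof.
move=> mu_ mv mu1 mv1 mu2 mv2 H.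
have m := mdist mu_ mv; have m1 := mdist mu1 mv1; have m2 := mdist mu2 mv2.
rewrite /l1dist -(ge0_integralD mu mD _ m1 _ m2); last 2 first.
- by move=> x _; rewrite lee_fin.
- by move=> x _; rewrite lee_fin.
apply: (ge0_le_integral mu mD _ m (emeasurable_funD m1 m2)).
- by move=> x _; rewrite lee_fin.
- by move=> x _; rewrite lee_fin.
Qed.

Lemma l1dist_indic A C : measurable A -> measurable C -> C `<=` A ->
  (l1dist (\1_C) (\1_A) = mu ((A `\` C) `&` D))%E.
Proof.
move=> mA mC CA; rewrite -(integral_indic mu mD (measurableD mA mC)).
apply: eq_integral => x _; congr (_%:E); rewrite !indicE in_setD.
have [xC|xC] := boolP (x \in C).
  by rewrite (mem_set (CA _ (set_mem xC))) subrr normr0.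
by rewrite andbT sub0r normrN normr_nat.
Qed.

Variable K : (T -> R) -> Prop.
Hypotheses (mK : forall g, K g -> measurable_fun setT g)
  (KC : forall g, K g -> K (fun x => 1 - g x))
  (KU : forall g h, K g -> K h -> K (fun x => g x + h x - g x * h x)).

(* g + h - g * h stands for the union, and stays between 0 and 1. *)
Definition approximable A := measurable A /\
  forall e : R, 0 < e -> exists g, [/\ K g, forall z, 0 <= g z <= 1 &
    (l1dist g \1_A <= e%:E)%E].

Lemma approximableC A : approximable A -> approximable (~` A).
Proof.
move=> [mA HA]; split; first exact: measurableC.
move=> e e0; have [g [tg g01 ge]] := HA e e0.
exists (fun z => 1 - g z); split; first exact: KC.
- by move=> z; have /andP[? ?] := g01 z; apply/andP; split; lra.
- rewrite (_ : l1dist _ _ = l1dist g \1_A)//; apply: eq_integral => x _.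
  congr (_%:E); rewrite (_ : \1_(~` A) x = 1 - \1_A x :> R).
    by rewrite distrC; congr (`|_|); ring.
  by rewrite !indicE in_setC; case: (_ \in _); rewrite /= ?subrr ?subr0.
Qed.

Let union_arith (g h a b : R) : 0 <= g <= 1 -> 0 <= h <= 1 -> a = 0 \/ a = 1 ->
  `|g + h - g * h - (a + b - a * b)| <= `|g - a| + `|h - b|.
Proof.
move=> /andP[g0 g1] /andP[h0 h1] a01.
rewrite (_ : _ - _ = (g - a) * (1 - h) + (h - b) * (1 - a)); last by ring.
apply: le_trans (ler_normD _ _) _; rewrite !normrM; apply: lerD.
  by rewrite ler_piMr// ger0_norm ?subr_ge0//; lra.
by rewrite ler_piMr//; case: a01 => ->; rewrite ?subr0 ?subrr ?normr1 ?normr0.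
Qed.

Lemma approximableU A C : approximable A -> approximable C ->
  approximable (A `|` C).
Proof.
move=> [mA HA] [mC HC]; split; first exact: measurableU.
move=> e e0; have e2 : 0 < e / 2 by rewrite divr_gt0.
have [g [tg g01 ge]] := HA _ e2; have [h [th h01 he]] := HC _ e2.
have tgh := KU tg th.
exists (fun z => g z + h z - g z * h z); split => //.
- by move=> z; have /andP[? ?] := g01 z; have /andP[? ?] := h01 z; nra.
- rewrite [e]splitr EFinD; apply: le_trans (leeD ge he).
  apply: l1dist_le; [exact: mK|apply: measurable_indic; exact: measurableU
    |exact: mK|exact: measurable_indic|exact: mK|exact: measurable_indic|].
  move=> x; rewrite (_ : \1_(A `|` C) x = \1_A x + \1_C x - \1_A x * \1_C x :> R).
    apply: union_arith => //.
    by rewrite indicE; case: (_ \in _); [right|left].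
  rewrite !indicE in_setU; case: (_ \in _); case: (_ \in _) => /=;
    rewrite /= ?mulr1n ?mulr0n; ring.
Qed.

Lemma approximable_approx A : measurable A ->
  (forall e : R, 0 < e ->
    exists2 C, approximable C & (l1dist (\1_C) (\1_A) <= e%:E)%E) ->
  approximable A.
Proof.
move=> mA H; split => // e e0; have e2 : 0 < e / 2 by rewrite divr_gt0.
have [C [mC HC] CA] := H _ e2; have [g [tg g01 gC]] := HC _ e2.
exists g; split => //; rewrite [e]splitr EFinD; apply: le_trans (leeD gC CA).
by apply: l1dist_le; [exact: mK|exact: measurable_indic|exact: mK
  |exact: measurable_indic|exact: measurable_indic|exact: measurable_indic|
   move=> x; exact: ler_distD].
Qed.

(** Finite unions exhaust the countable union in measure, by continuity from above inside [D], whose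
    measure is finite. *)
Lemma approximable_bigcup (F : (set T)^nat) :
  (forall n, approximable (F n)) -> approximable (\bigcup_n F n).
Proof.
move=> HF; have mF n : measurable (F n) := (HF n).1.
have mUF : measurable (\bigcup_n F n) by exact: bigcupT_measurable.
pose G n := \big[setU/set0]_(i < n.+1) F i.
have aG n : approximable (G n).
  rewrite /G; elim: n => [|n IHn]; first by rewrite big_ord1.
  by rewrite big_ord_recr/=; exact: approximableU.
have mG n : measurable (G n) := (aG n).1.
have UG : \bigcup_n G n = \bigcup_n F n.
  apply/seteqP; split => x [n _].
    by rewrite /G -bigcup_mkord => -[i _ Fi]; exists i.
  by move=> Fnx; exists n => //; rewrite /G big_ord_recr/=; right.
apply: approximable_approx => // e e0.
have GF n : G n `<=` \bigcup_n F n by rewrite -UG; exact: bigcup_sup.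
pose E n := ((\bigcup_n F n) `\` G n) `&` D.
have mE n : measurable (E n) by apply: measurableI => //; exact: measurableD.
have E0 : \bigcap_n E n = set0.
  apply/seteqP; split => // x /= Ex.
  have [[[n _ Fnx] _] _] := Ex 0%N I.
  by have [[_ nG] _] := Ex n I; apply: nG; rewrite /G big_ord_recr/=; right.
have cE : (mu \o E) n @[n --> \oo] --> mu set0.
  rewrite -E0; apply: nonincreasing_cvg_mu => //.
  - apply: le_lt_trans fD; apply: le_measure; rewrite ?inE//.
    exact: subIsetr.
  - by rewrite E0.
  - move=> m n mn; apply/subsetPset; apply: setSI; apply: setDS.
    by apply: subset_bigsetU; rewrite ltnS.
have [n En] : exists n, (mu (E n) < e%:E)%E.
  apply/not_existsP => nE; suff : (e%:E <= mu set0)%E.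
    by rewrite measure0 lee_fin leNgt e0.
  apply: (cvge_to_ge cE); apply: nearW => n.
  by rewrite leNgt; apply/negP; exact: nE.
exists (G n); first exact: aG.
by rewrite l1dist_indic// ltW.
Qed.

Lemma sigma_algebra_approximable : approximable set0 ->
  sigma_algebra setT approximable.
Proof.
move=> a0; split => // [A|F HF]; first by rewrite setTD; exact: approximableC.
exact: approximable_bigcup.
Qed.

End l1_approximation.

(** * From rays to Lebesgue measurable sets of the plane *)

Section plane_approximation.
Context {R : realType}.
Notation T := (lebesgue_plane R).
Notation B := (measurableTypeR R * measurableTypeR R)%type.
Notation mu := (lebesgue_measure2 R).
Notation leb := (@lebesgue_measure R).
Variable M : R.
Hypothesis M0 : 0 <= M.

Let K (g : T -> R) := tensor (g : R * R -> R).

Lemma tensor_measurable g : tensor g -> measurable_fun [set: T] (g : T -> R).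
Proof.
move=> tg; apply: borel_lebesgue_fun; apply: continuous_borel_plane.
by apply: C1plane_continuous; exact: tensor_C1plane.
Qed.

Let KC (g : T -> R) : K g -> K (fun x => 1 - g x).
Proof. exact: (tensor_sub (tensor_cst 1)). Qed.

Let KU (g h : T -> R) : K g -> K h -> K (fun x => g x + h x - g x * h x).
Proof. by move=> tg th; exact: (tensor_sub (tensor_add tg th) (tensor_prod tg th)). Qed.

Let mbox : measurable (box M : set T) := measurable_box M.

Let appr (A : set T) := approximable mu (box M) K A.

Let appr_sigma_algebra : appr set0 -> sigma_algebra setT appr :=
  sigma_algebra_approximable mbox (box_lty M) tensor_measurable KC KU.

Let appr0 : appr set0.
Proof.
split=> // e e0; exists (fun=> 0); split; first exact: tensor_cst.
- by move=> z; rewrite lexx ler01.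
- rewrite /l1dist integral0_eq ?lee_fin ?ltW// => x _.
  by rewrite indicE in_set0 subr0 normr0.
Qed.

(** [pi] stands for either coordinate. A step descending from 1 to 0 just before [r] differs from
    the indicator only on a thin strip, whose area in the box is controlled by the second
    hypothesis. *)
Let approximable_ray (pi : R * R -> R) (r : R) :
  (forall a, C1line a -> tensor (fun z => a (pi z))) ->
  (forall I : set (measurableTypeR R), measurable I ->
     measurable (pi @^-1` I : set B) /\
     (mu (pi @^-1` I `&` box M) <= leb I * (2 * M)%:E)%E) ->
  appr (pi @^-1` `]-oo, r[).
Proof.
move=> tpi strip.
have mray : measurable (pi @^-1` `]-oo, r[ : set T).
  apply: borel_lebesgue_plane; have [] := strip `]-oo, r[%classic; last by [].
  exact: measurable_itv.
split; first exact: mray.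
move=> e e0.
(* The strip has width [1 / k], hence area at most [2 * M / k <= e] in the box; the [+ 1] keeps [k]
   positive when [M] is 0. *)
pose k := (2 * M + 1) / e.
have k0 : 0 < k by rewrite divr_gt0// ltr_wpDl// mulr_ge0.
pose I : set (measurableTypeR R) := [set` `](r - k^-1)%R, r[].
have [mS sI] : _ /\ _ := strip I (measurable_itv _).
have C1 : C1line (fun x => smoothstep ((- k) * x + k * r)).
  exact: (C1line_affine (- k) (k * r) C1line_smoothstep).
exists (fun z => smoothstep ((- k) * pi z + k * r)); split.
- exact: (tpi _ C1).
- by move=> z; rewrite smoothstep_ge0 smoothstep_le1.
- apply: (@le_trans _ _ (mu (pi @^-1` I `&` box M))).
    rewrite -(integral_indic mu mbox (borel_lebesgue_plane mS)).
    have m1 : measurable_fun (box M : set T) (fun z : T =>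
        (`|smoothstep ((- k) * pi z + k * r) - \1_(pi @^-1` `]-oo, r[) z|)%:E).
      apply/measurable_EFinP; apply: measurable_funTS.
      apply: (measurableT_comp (@normr_measurable R setT)).
      apply: measurable_funB; first exact: (tensor_measurable (tpi _ C1)).
      exact: measurable_indic.
    have m2 : measurable_fun (box M : set T) (fun z : T => (\1_(pi @^-1` I) z : R)%:E).
      apply/measurable_EFinP; apply: measurable_funTS; apply: measurable_indic.
      exact: borel_lebesgue_plane.
    apply: (ge0_le_integral mu mbox _ m1 m2).
    + by move=> z _; rewrite lee_fin.
    + move=> z _; rewrite lee_fin !indicE.
      have [zr|zr] := ltP (pi z) r; last first.
        rewrite memNset; last by rewrite /= in_itv/= ltNge zr.
        rewrite smoothstep_le0 ?subr0 ?normr0// addrC mulNr -mulrBr.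
        by rewrite pmulr_rle0// subr_le0.
      rewrite mem_set; last by rewrite /= in_itv.
      have [zk|zk] := ltP (r - k^-1) (pi z).
        rewrite mem_set; last by rewrite /I/= in_itv/= zk zr.
        rewrite distrC ger0_norm ?subr_ge0 ?smoothstep_le1//.
        by rewrite gerBl smoothstep_ge0.
      rewrite smoothstep_ge1 ?subrr ?normr0// mulNr addrC -mulrBr.
      rewrite -(@ler_pM2l _ k^-1) ?invr_gt0// mulr1 mulKf ?gt_eqF//.
      by rewrite lerBrDr addrC -lerBrDr.
  apply: le_trans sI _.
  rewrite /I lebesgue_measure_itv/= lte_fin gtrBl invr_gt0 k0.
  rewrite -EFinB -EFinM lee_fin opprB addrC subrK /k invf_div.
  rewrite mulrAC ler_pdivrMr; last by rewrite ltr_wpDl// mulr_ge0.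
  by rewrite ler_wpM2l ?(ltW e0)// lerDl.
Qed.

(** The sets with approximable preimage form a sigma-algebra containing the rays, which generate the
    Borel sets. *)
Let approximable_preimage (pi : R * R -> R) :
  (forall r : R, appr (pi @^-1` `]-oo, r[)) ->
  forall A : set (measurableTypeR R), measurable A -> appr (pi @^-1` A).
Proof.
move=> Hray A mA.
have [_ aC aU] := appr_sigma_algebra appr0.
pose G : set (set R) := [set A | appr (pi @^-1` A)].
have sG : sigma_algebra setT G.
  split; rewrite /G/=.
  - by rewrite preimage_set0.
  - by move=> C /aC; rewrite !setTD preimage_setC.
  - by move=> F HF; rewrite preimage_bigcup; exact: aU.
have GG : @RGenInftyO.G R `<=` G by move=> _ [r ->]; exact: Hray.
apply: (smallest_sub sG GG).
have mE := @RGenInftyO.measurableE R.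
have mA' : (@ocitv R).-sigma.-measurable A by [].
by rewrite mE in mA'.
Qed.

Let itvM : set (measurableTypeR R) := [set` `[(- M)%R, M]].
Let mitvM : measurable itvM. Proof. exact: measurable_itv. Qed.

Let leb_itvM : leb itvM = (2 * M)%:E.
Proof.
rewrite /itvM lebesgue_measure_itv/= lte_fin.
case: ltP => [_|MM]; first by rewrite -EFinB; congr (_%:E); ring.
have -> : M = 0 by apply/eqP; rewrite eq_le M0 andbT; move: MM; lra.
by rewrite mulr0.
Qed.

Let mu_setX (I J : set (measurableTypeR R)) : measurable I -> measurable J ->
  mu (I `*` J) = (leb I * leb J)%E.
Proof.
move=> mI mJ; rewrite lebesgue_measure2E; last exact: measurableX.
exact: product_measure1E.
Qed.

Let leb_itvM_ge0 : (0 <= (2 * M)%:E :> \bar R)%E.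
Proof. by rewrite lee_fin mulr_ge0. Qed.

Let leb_setI (I : set (measurableTypeR R)) : measurable I ->
  (leb (I `&` itvM) <= leb I)%E.
Proof.
by move=> mI; apply: le_measure; rewrite ?inE//; exact: measurableI.
Qed.

Let appr_fst : forall A : set (measurableTypeR R), measurable A ->
  appr (fst @^-1` A).
Proof.
apply: approximable_preimage => r; apply: approximable_ray; first exact: tensor_fst.
move=> I mI; split.
  rewrite (_ : _ @^-1` _ = I `*` setT); first exact: measurableX.
  by apply/seteqP; split => x //= [].
rewrite (_ : _ `&` _ = (I `&` itvM) `*` itvM); last first.
  by rewrite boxE; apply/seteqP; split => x; [move=> [? [? ?]]|move=> [[? ?] ?]].
rewrite mu_setX//; last exact: measurableI.
by rewrite leb_itvM; apply: lee_wpmul2r => //; exact: leb_setI.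
Qed.

Let appr_snd : forall A : set (measurableTypeR R), measurable A ->
  appr (snd @^-1` A).
Proof.
apply: approximable_preimage => r; apply: approximable_ray; first exact: tensor_snd.
move=> I mI; split.
  rewrite (_ : _ @^-1` _ = setT `*` I); first exact: measurableX.
  by apply/seteqP; split => x //= [].
rewrite (_ : _ `&` _ = itvM `*` (I `&` itvM)); last first.
  by rewrite boxE; apply/seteqP; split => x; [move=> [? [? ?]]|move=> [? [? ?]]].
rewrite mu_setX//; last exact: measurableI.
by rewrite leb_itvM muleC; apply: lee_wpmul2r => //; exact: leb_setI.
Qed.

Let appr_borel (A : set B) : measurable A -> appr A.
Proof.
have sA := appr_sigma_algebra appr0.
rewrite measurable_prod_measurableType; apply: (smallest_sub sA).
move=> _ [I mI [J mJ <-]].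
rewrite (_ : I `*` J = ~` (~` (fst @^-1` I) `|` ~` (snd @^-1` J))).
  have aI := approximableC KC (appr_fst mI); have aJ := approximableC KC (appr_snd mJ).
  exact: (approximableC KC (approximableU mbox tensor_measurable KU aI aJ)).
by rewrite setCU !setCK.
Qed.

(** The completed measure is an infimum over sequences of Borel sets covering [A]; [C] is the union
    of a nearly optimal sequence. *)
Lemma borel_cover (A : set T) (e : R) : measurable A -> (mu A < +oo)%E -> 0 < e ->
  exists C : set B, [/\ measurable C, A `<=` C & (mu (C `\` A) <= e%:E)%E].
Proof.
move=> mA Afin e0.
have Af : mu A \is a fin_num by rewrite ge0_fin_numE.
have [_ [F [mF AF] <-] Fe] := lb_ereal_inf_adherent e0 Af.
pose C : set B := \bigcup_n F n.
have mC : measurable C by exact: bigcupT_measurable.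
exists C; split => //.
have mCT := borel_lebesgue_plane mC.
have muC : (mu C <= mu A + e%:E)%E.
  apply: le_trans (ltW Fe).
  rewrite lebesgue_measure2E//.
  exact: (measure_sigma_subadditive (borel_measure2 R) mF mC).
rewrite measureD//; last first.
  by apply: le_lt_trans muC _; rewrite lte_add_pinfty// ltry.
rewrite (setIidr AF); rewrite leeBlDr//.
by rewrite addeC.
Qed.

Lemma approximable_lebesgue (A : set T) : measurable A -> (mu A < +oo)%E -> appr A.
Proof.
move=> mA Afin; apply: (approximable_approx mbox tensor_measurable mA) => e e0.
have [C [mC AC CA]] := borel_cover mA Afin e0.
exists C; first exact: appr_borel.
rewrite /l1dist.
under eq_integral do rewrite distrC.
have mCT := borel_lebesgue_plane mC.
have := l1dist_indic mu mbox mCT mA AC; rewrite /l1dist => ->.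
apply: le_trans CA; apply: le_measure; rewrite ?inE.
- by apply: measurableI => //; exact: measurableD.
- exact: measurableD.
- exact: subIsetl.
Qed.

End plane_approximation.

(** * A crude isoperimetric inequality *)

Section isoperimetric.
Context {R : realType}.
Notation T := (lebesgue_plane R).
Notation B := (measurableTypeR R * measurableTypeR R)%type.
Notation mu := (lebesgue_measure2 R).
Notation leb := (@lebesgue_measure R).

Lemma ge0_plane_integralE (f : B -> \bar R) : measurable_fun setT f ->
  (forall z, 0 <= f z)%E ->
  (\int[mu]_(z in (setT : set T)) f z = \int[(leb \x leb)]_z f z)%E.
Proof.
move=> mf f0.
pose phi (x : T) : B := x.
have mphi : measurable_fun setT phi.
  by move=> _ Y mY; rewrite setTI; exact: borel_lebesgue_plane.
have := ge0_integral_pushforward mphi mu measurableT mf (fun x _ => f0 x).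
rewrite preimage_setT/= => <-.
apply: eq_measure_integral => A mA _ /=.
by rewrite /pushforward preimage_id lebesgue_measure2E.
Qed.

Lemma continuous_bounded_integrable (W : set T) (f : R * R -> R) (M : R) :
  measurable W -> W `<=` box M -> continuous f ->
  mu.-integrable W (EFin \o f).
Proof.
move=> mW WM cf.
apply: (@integrableS _ _ _ mu (box M : set T)) => //; first exact: measurable_box.
apply: measurable_bounded_integrable.
- exact: measurable_box.
- exact: box_lty.
- by apply: measurable_funTS; apply: borel_lebesgue_fun; exact: continuous_borel_plane.
- have /compact_bounded[K [Kr HK]] : compact (f @` box M).
    apply: continuous_compact; last exact: compact_box.
    exact: continuous_subspaceT.
  by exists K; split => // y Ky x Mx; apply: (HK y Ky); exists x.
Qed.

Let scale_arith (k a b : R) : 0 <= k -> k <= 1 -> a ^+ 2 + b ^+ 2 <= 1 ->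
  (k * a) ^+ 2 + (k * b) ^+ 2 <= 1.
Proof.
move=> k0 k1 ab1; rewrite !exprMn -mulrDr mulr_ile1 ?sqr_ge0 ?addr_ge0 ?expr_le1//;
  exact: sqr_ge0.
Qed.

Lemma flux_bounded_set (W : set T) (c : R * R) (t P : R) (f g : R * R -> R) :
  0 < t -> W `<=` euclid_ball c t ->
  (forall f g, test_field f g -> flux W f g <= P) ->
  C1plane f -> C1plane g -> (forall x, f x ^+ 2 + g x ^+ 2 <= 1) ->
  flux W f g <= P.
Proof.
move=> t0 Wt HP Cf Cg fg1.
have tt : t < t + 1 by rewrite ltrDl.
pose chi := cutoff c t (t + 1).
have Cchi : C1plane chi by exact: C1plane_cutoff.
have bchi : bounded_support chi by exact: bounded_support_cutoff.
have -> : flux W f g = flux W (fun z => chi z * f z) (fun z => chi z * g z).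
  apply: eq_Rintegral => x /set_mem /Wt.
  rewrite euclid_ballE ?(ltW t0)// => /ltW xt.
  rewrite (plane_div_cutoff c x t (t + 1) Cf Cg).
  by rewrite (cutoff_in t0 tt xt) (cutoff_weight_in t0 tt xt) mul1r mul0r subr0.
apply: HP; split; first exact: admissibleM.
move=> x; exact: (scale_arith (cutoff_ge0 _ _ _ _) (cutoff_le1 _ _ _ _) (fg1 x)).
Qed.

Lemma D2_swap (f : R * R -> R) z :
  'D_(0, 1) (fun z => f (z.2, z.1)) z = 'D_(1, 0) f (z.2, z.1).
Proof.
rewrite /derive.
by rewrite (_ : (fun h : R => h^-1 *: (f ((h *: (0, 1) + z).2, (h *: (0, 1) + z).1)
   - f (z.2, z.1))) =
  fun h => h^-1 *: (f (h *: (1, 0) + (z.2, z.1)) - f (z.2, z.1))).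
Qed.

(** By Tonelli the left-hand side is the integral of [g] over the square of side [rho] with upper
    right corner [(x, y)], and this square lies in [box M]. *)
Lemma rectangle_average_le (rho M : R) (g h1 h2 : R * R -> R) (x y : R) :
  0 < rho -> tensor g -> tensor h1 -> (forall z, 0 <= g z) ->
  (forall s, (\int[leb]_(t in `[(x - rho)%R, x]) (g (t, s))%:E =
     (rho * h1 (x, s))%:E)%E) ->
  (\int[leb]_(s in `[(y - rho)%R, y]) (h1 (x, s))%:E = (rho * h2 (x, y))%:E)%E ->
  box (M - rho) (x, y) ->
  ((rho * (rho * h2 (x, y)))%:E <= \int[mu]_(z in (box M : set T)) (g z)%:E)%E.
Proof.
move=> rho0 tg th1 g0 H1 H2 [xM yM].
pose I : set (measurableTypeR R) := [set` `[(x - rho)%R, x]].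
pose J : set (measurableTypeR R) := [set` `[(y - rho)%R, y]].
have mI : measurable I by exact: measurable_itv.
have mJ : measurable J by exact: measurable_itv.
have mIJ : measurable (I `*` J : set B) by exact: measurableX.
pose F (z : B) : \bar R := ((g z)%:E * (\1_(I `*` J) z)%:E)%E.
have cg : continuous g by apply: C1plane_continuous; exact: tensor_C1plane.
have mg : measurable_fun [set: B] (g : B -> R) by exact: continuous_borel_plane.
have mF : measurable_fun setT F.
  have m1 : measurable_fun [set: B] (fun z : B => (g z)%:E) by apply/measurable_EFinP.
  have m2 : measurable_fun [set: B] (fun z : B => (\1_(I `*` J) z : R)%:E).
    by apply/measurable_EFinP; exact: measurable_indic.
  exact: (emeasurable_funM m1 m2).
have F0 z : (0 <= F z)%E by rewrite mule_ge0// lee_fin.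
have -> : (rho * (rho * h2 (x, y)))%:E = (\int[mu]_(z in (setT : set T)) F z)%E.
  rewrite (ge0_plane_integralE mF F0) (fubini_tonelli2 F mF F0)/=.
  transitivity (\int[leb]_(s in J) (rho * h1 (x, s))%:E)%E.
    have ch1 : continuous (fun s => h1 (x, s)).
      by apply: continuous_slice2; apply: C1plane_continuous; exact: tensor_C1plane.
    have i1 : leb.-integrable J (EFin \o (fun s => h1 (x, s))).
      exact: continuous_itv_integrable.
    by rewrite EFinM -H2 -(integralZl mJ i1).
  rewrite [LHS]integral_mkcond; apply: eq_integral => s _.
  rewrite patchE /fubini_G; case: ifPn => sJ.
    rewrite -H1 [LHS]integral_mkcond; apply: eq_integral => t _.
    rewrite patchE /F indicE in_setX sJ andbT.
    by case: (t \in I); rewrite ?mule1 ?mule0.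
  apply/esym/integral0_eq => t _.
  by rewrite /F indicE in_setX (negbTE sJ) andbF mule0.
have gM : measurable_fun (box M : set T) (fun z : T => (g z)%:E).
  apply/measurable_EFinP; apply: measurable_funTS; exact: borel_lebesgue_fun.
rewrite [leRHS]integral_mkcond.
have mFT : measurable_fun [set: T] (F : T -> \bar R).
  by move=> _ Y mY; apply: borel_lebesgue_plane; exact: mF.
have mgM := (measurable_restrictT _ (measurable_box M)).1 gM.
apply: (ge0_le_integral mu measurableT (fun z _ => F0 z) mFT mgM) => z _.
rewrite patchE /F indicE; case: ifPn => zM.
  by case: (z \in _); rewrite ?mule1 ?mule0 ?lee_fin.
rewrite memNset ?mule0// => -[/= zI zJ]; move/negP: zM; apply; apply/mem_set.
move: zI zJ xM yM; rewrite /I /J/= !in_itv/= !ler_norml.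
by move=> /andP[? ?] /andP[? ?] /andP[? ?] /andP[? ?]; rewrite /box/= !ler_norml;
  split; apply/andP; split; lra.
Qed.

Section bounded_perimeter.
Variables (W : set T) (c : R * R) (t P : R).
Hypotheses (mW : measurable W) (t0 : 0 < t) (Wt : W `<=` euclid_ball c t)
  (HP : forall f g, test_field f g -> flux W f g <= P).

Let fW : finite_area W.
Proof. exact: (finite_areaS mW Wt (finite_area_euclid_ball c (ltW t0))). Qed.

Let boxW : exists M, W `<=` box M.
Proof.
have [M HM] := sqdist_box c t; exists M => x /Wt.
by rewrite euclid_ballE ?(ltW t0)//; exact: HM.
Qed.

Let int_cont (f : R * R -> R) : continuous f -> mu.-integrable W (EFin \o f).
Proof. by move=> cf; have [M WM] := boxW; exact: (continuous_bounded_integrable mW WM). Qed.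

Let bound_scaled (rho : R) (f g k : R * R -> R) : 0 < rho ->
  C1plane f -> C1plane g -> (forall x, f x ^+ 2 + g x ^+ 2 <= rho ^+ 2) ->
  (forall x, plane_div f g x = k x) -> continuous k ->
  \int[mu]_(x in W) k x <= rho * P.
Proof.
move=> rho0 Cf Cg fg Hk ck.
have Cf' := C1plane_mul (C1plane_cst rho^-1) Cf.
have Cg' := C1plane_mul (C1plane_cst rho^-1) Cg.
have := flux_bounded_set t0 Wt HP Cf' Cg' _.
have -> : flux W (fun z => rho^-1 * f z) (fun z => rho^-1 * g z) =
    rho^-1 * \int[mu]_(x in W) k x.
  rewrite -(RintegralZl rho^-1 mW (int_cont ck)); apply: eq_Rintegral => x _.
  rewrite (plane_divM x (C1plane_cst rho^-1) Cf Cg) !D_cst !mul0r !addr0.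
  by rewrite Hk.
move=> H; rewrite -ler_pdivrMl//; apply: H => x.
rewrite !exprMn -mulrDr exprVn mulrC ler_pdivrMr ?exprn_gt0// mul1r.
exact: fg.
Qed.

Let bound1 (rho : R) (g h psi : R * R -> R) : 0 < rho ->
  tensor g -> tensor h -> tensor psi -> (forall z, `|psi z| <= rho) ->
  (forall z, 'D_(1, 0) psi z = g z - h z) ->
  \int[mu]_(x in W) (g x - h x) <= rho * P.
Proof.
move=> rho0 tg th tpsi psir Dpsi.
apply: (bound_scaled rho0 (tensor_C1plane tpsi) (C1plane_cst 0)).
- move=> x; rewrite expr0n addr0 -real_normK ?num_real//.
  by rewrite ler_pXn2r// ?nnegrE// ltW.
- by move=> x; rewrite /plane_div D_cst addr0 Dpsi.
- by apply: C1plane_continuous; apply: tensor_C1plane; exact: tensor_sub.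
Qed.

Let bound2 (rho : R) (g h psi : R * R -> R) : 0 < rho ->
  tensor g -> tensor h -> tensor psi -> (forall z, `|psi z| <= rho) ->
  (forall z, 'D_(0, 1) psi z = g z - h z) ->
  \int[mu]_(x in W) (g x - h x) <= rho * P.
Proof.
move=> rho0 tg th tpsi psir Dpsi.
apply: (bound_scaled rho0 (C1plane_cst 0) (tensor_C1plane tpsi)).
- move=> x; rewrite expr0n add0r -real_normK ?num_real//.
  by rewrite ler_pXn2r// ?nnegrE// ltW.
- by move=> x; rewrite /plane_div D_cst add0r Dpsi.
- by apply: C1plane_continuous; apply: tensor_C1plane; exact: tensor_sub.
Qed.

Let l1_lower (M e : R) (g : R * R -> R) : W `<=` box M -> tensor g ->
  (forall z, 0 <= g z <= 1) -> (l1dist mu (box M) g \1_W <= e%:E)%E ->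
  area W - e <= \int[mu]_(x in W) g x.
Proof.
move=> WM tg g01 ge.
have cg : continuous g by apply: C1plane_continuous; exact: tensor_C1plane.
have c1g : continuous (fun z => 1 - g z).
  by move=> z; apply: cvgB; [exact: cvg_cst|exact: cg].
have i1 := int_cont (C1plane_continuous (C1plane_cst 1)).
have e1 : \int[mu]_(x in W) (1 - g x) = area W - \int[mu]_(x in W) g x.
  by rewrite (RintegralB mW i1 (int_cont cg)) Rintegral_cst// mul1r.
suff : \int[mu]_(x in W) (1 - g x) <= e by rewrite e1 lerBlDr addrC -lerBlDr.
rewrite -lee_fin /Rintegral fineK; last exact: integrable_fin_num (int_cont c1g).
apply: le_trans ge; rewrite /l1dist.
have mT : measurable_fun (box M : set T) (fun x : T => (`|g x - \1_W x|)%:E).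
  apply/measurable_EFinP; apply: measurable_funTS.
  apply: (measurableT_comp (@normr_measurable R setT)).
  apply: measurable_funB; first exact: (tensor_measurable tg).
  exact: measurable_indic.
apply: (@le_trans _ _ (\int[mu]_(x in W) (`|g x - \1_W x|)%:E)%E).
  rewrite le_eqVlt; apply/orP; left; apply/eqP; apply: eq_integral => x xW.
  rewrite indicE xW distrC ger0_norm// subr_ge0.
  by have /andP[] := g01 x.
exact: (ge0_subset_integral mu mW (measurable_box M) mT (fun x _ => _) WM).
Qed.

Let l1_upper (M e : R) (g : R * R -> R) : W `<=` box M -> tensor g ->
  (forall z, 0 <= g z <= 1) -> (l1dist mu (box M) g \1_W <= e%:E)%E ->
  (\int[mu]_(z in (box M : set T)) (g z)%:E <= (area W + e)%:E)%E.
Proof.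
move=> WM tg g01 ge.
have mb := measurable_box M.
have mi : measurable_fun (box M : set T) (fun x : T => (\1_W x : R)%:E).
  by apply/measurable_EFinP; apply: measurable_funTS; exact: measurable_indic.
have mT : measurable_fun (box M : set T) (fun x : T => (`|g x - \1_W x|)%:E).
  apply/measurable_EFinP; apply: measurable_funTS.
  apply: (measurableT_comp (@normr_measurable R setT)).
  apply: measurable_funB; first exact: (tensor_measurable tg).
  exact: measurable_indic.
have mg : measurable_fun (box M : set T) (fun x : T => (g x)%:E).
  by apply/measurable_EFinP; apply: measurable_funTS; exact: (tensor_measurable tg).
have -> : (area W + e)%:E = (mu (W `&` box M) + e%:E)%E.
  by rewrite (setIidl WM) (area_fin fW).
apply: (@le_trans _ _ (mu (W `&` box M) + l1dist mu (box M) g \1_W)%E);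
  last by rewrite leeD2l.
rewrite -(integral_indic mu mb mW) /l1dist.
rewrite -(ge0_integralD mu mb _ mi _ mT); last 2 first.
- by move=> x _; rewrite lee_fin indicE.
- by move=> x _; rewrite lee_fin.
apply: (ge0_le_integral mu mb _ mg (emeasurable_funD mi mT)).
- by move=> x _; rewrite lee_fin; have /andP[] := g01 x.
- move=> x _; rewrite lee_fin; have := ler_norm (g x - \1_W x).
  by rewrite lerBlDl.
Qed.

Let combine_arith (A e X Y Z rho Q D : R) :
  A - e <= X + Y + Z -> X <= rho * Q -> Y <= rho * Q -> Z <= A * ((A + e) / D) ->
  A <= 2 * rho * Q + A ^+ 2 / D + (1 + A / D) * e.
Proof.
have -> : A * ((A + e) / D) = A ^+ 2 / D + A / D * e by ring.
have -> : (1 + A / D) * e = e + A / D * e by ring.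
rewrite -(mulrA 2); move: (A ^+ 2 / D) (A / D * e) (rho * Q) => u v w *; lra.
Qed.

(* g approximates the indicator of W, h1 averages g over horizontal segments of
   length rho and h2 averages h1 over vertical ones. Then g - h1 and h1 - h2 are
   divergences of fields bounded by rho, while h2 <= (area W + e) / rho ^+ 2. *)
Lemma isoperimetric_scale (rho : R) : 0 < rho ->
  area W <= 2 * rho * P + area W ^+ 2 / rho ^+ 2.
Proof.
move=> rho0; have [M WM] := boxW.
pose N := M + rho.
have WN : W `<=` box N.
  by apply: (subset_trans WM); apply: le_box; rewrite lerDl ltW.
(* N may be negative, but only when W is empty. *)
have WNn : W `<=` box `|N| by apply: (subset_trans WN); apply: le_box; exact: ler_norm.
apply: (@ler_linear_eps _ _ _ (1 + area W / rho ^+ 2)) => e e0.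
have [_ /(_ e e0)[g [tg g01 ge]]] :=
  @approximable_lebesgue R `|N| (normr_ge0 _) W mW fW.2.
have [h1 [psi1 [[th1 h101] tpsi1 psi1r Dpsi1 H1]]] := tensor_average rho0 tg g01.
have tk := tensor_swap th1.
have [h' [psi' [[th' h'01] tpsi' psi'r Dpsi' H']]] :=
  tensor_average rho0 tk (fun z => h101 (z.2, z.1)).
pose h2 (z : R * R) := h' (z.2, z.1).
pose psi2 (z : R * R) := psi' (z.2, z.1).
have th2 : tensor h2 by exact: tensor_swap th'.
have tpsi2 : tensor psi2 by exact: tensor_swap tpsi'.
have b1 := bound1 rho0 tg th1 tpsi1 psi1r Dpsi1.
have Dpsi2 z : 'D_(0, 1) psi2 z = h1 z - h2 z.
  by rewrite /psi2 (D2_swap psi') Dpsi'/= -surjective_pairing.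
have b2 := bound2 rho0 th1 th2 tpsi2 (fun z => psi'r (z.2, z.1)) Dpsi2.
have low := l1_lower WNn tg g01 ge.
have up := l1_upper WNn tg g01 ge.
have ct (f : R * R -> R) : tensor f -> continuous f.
  by move=> tf; apply: C1plane_continuous; exact: tensor_C1plane.
have b3 : \int[mu]_(x in W) h2 x <= area W * ((area W + e) / rho ^+ 2).
  set k := (area W + e) / rho ^+ 2.
  have -> : area W * k = \int[mu]_(x in W) (fun=> k) x.
    by rewrite Rintegral_cst// mulrC.
  have i1 := int_cont (ct _ th2).
  have i2 := int_cont (C1plane_continuous (C1plane_cst k)).
  suff H : forall z, W z -> h2 z <= k by exact: (le_Rintegral mW i1 i2 H).
  move=> [x y] /WM xyM; rewrite ler_pdivlMr ?exprn_gt0// mulrC expr2 -mulrA -lee_fin.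
  apply: le_trans up.
  apply: (rectangle_average_le (h1 := h1) rho0 tg th1).
  - by move=> z; have /andP[] := g01 z.
  - by move=> s; exact: H1.
  - exact: H'.
  - by apply: le_box xyM; rewrite lerBrDr (le_trans _ (ler_norm _)).
have eg : \int[mu]_(x in W) g x = \int[mu]_(x in W) (g x - h1 x) +
    \int[mu]_(x in W) (h1 x - h2 x) + \int[mu]_(x in W) h2 x.
  rewrite (RintegralB mW (int_cont (ct _ tg)) (int_cont (ct _ th1))).
  rewrite (RintegralB mW (int_cont (ct _ th1)) (int_cont (ct _ th2))).
  by rewrite addrA subrK subrK.
by move: low b1 b2 b3; rewrite eg; exact: combine_arith.
Qed.

Lemma isoperimetric : area W <= 32 * P ^+ 2.
Proof.
have [A0|A0] := eqVneq (area W) 0.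
  by rewrite A0 mulr_ge0// sqr_ge0.
have {A0} : 0 < area W by rewrite lt_def A0 area_ge0.
have := isoperimetric_scale; move: (area W) => A HA A0.
(* This scale turns the quadratic term into half the area, which is absorbed on the left; squaring
   [A / 2 <= 2 * rho * P] then gives 32. *)
pose rho := Num.sqrt (2 * A).
have rho0 : 0 < rho by rewrite sqrtr_gt0 mulr_gt0.
have rho2 : rho ^+ 2 = 2 * A by rewrite sqr_sqrtr// ltW// mulr_gt0.
have := HA rho rho0; rewrite rho2.
have -> : A ^+ 2 / (2 * A) = A / 2 by field; rewrite gt_eqF.
clear HA => h1.
have h2 : A / 2 <= 2 * rho * P by lra.
have h3 : (A / 2) ^+ 2 <= (2 * rho * P) ^+ 2.
  by rewrite ler_sqr// ?nnegrE; [lra|apply: le_trans h2; lra].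
have : A * A <= A * (32 * P ^+ 2).
  have -> : A * (32 * P ^+ 2) = 16 * (2 * A) * P ^+ 2 by ring.
  rewrite -rho2; move: h3; rewrite !exprMn exprVn; lra.
by rewrite ler_pM2l.
Qed.

End bounded_perimeter.

End isoperimetric.

(** * Minimizers *)

Section minimizer.
Context {R : realType}.
Notation T := (lebesgue_plane R).
Notation mu := (lebesgue_measure2 R).
Variables (lambda : R) (Omega S : set (R * R)).
Hypotheses (l0 : 0 < lambda) (bO : bounded_set Omega)
  (mO : measurable (Omega : set T)) (minS : is_minimizer lambda Omega S).

Let mS : measurable (S : set T). Proof. by case: minS. Qed.

Let fO : finite_area Omega.
Proof.
have [M OM] := bounded_set_box bO.
exact: (finite_areaS mO OM (conj (measurable_box M) (box_lty M))).
Qed.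

Let msym (A : set T) : measurable A -> measurable (A `+` Omega : set T).
Proof. by move=> mA; apply: measurableU; exact: measurableD. Qed.

(** The empty set is a competitor of energy [lambda] times the area of [Omega]. Both terms of the
    energy of [S] are therefore finite and can be handled as reals. *)
Let energy_finite : (energy lambda Omega S < +oo)%E.
Proof.
apply: le_lt_trans (minS.2 set0 (@measurable0 _ T)) _.
have p0 : (perimeter (@set0 (R * R)) <= 0%:E)%E.
  by apply: perimeter_le => // f g _; rewrite /flux Rintegral_set0.
rewrite /energy set0Y; apply: lte_add_pinfty; first exact: le_lt_trans p0 (ltry _).
by rewrite (area_fin fO) -EFinM ltry.
Qed.

Let perimeter_finite : perimeter S \is a fin_num.
Proof.
rewrite ge0_fin_numE ?perimeter_ge0//; apply: le_lt_trans energy_finite.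
by rewrite /energy leeDl// mule_ge0// lee_fin ltW.
Qed.

Let fD : finite_area (S `+` Omega).
Proof.
split; first exact: msym.
have : (lambda%:E * mu (S `+` Omega) < +oo)%E.
  apply: le_lt_trans energy_finite.
  by rewrite /energy leeDr// perimeter_ge0.
rewrite -ge0_fin_numE; last by rewrite mule_ge0// lee_fin ltW.
move=> h; rewrite ltey; apply/eqP => mi; move: h.
by rewrite mi gt0_muley// lte_fin.
Qed.

Let P := fine (perimeter S).

Let flux_le_P f g : test_field f g -> flux S f g <= P.
Proof.
move=> tfg; have := perimeter_ge mS tfg.
by rewrite -(fineK perimeter_finite) lee_fin.
Qed.

Let fill_arith (Q pD A1 A2 D D' : R) : D' + A1 = D + A2 ->
  pD + lambda * D <= Q + lambda * D' -> pD + lambda * A1 <= Q + lambda * A2.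
Proof.
move=> h; have -> : A1 = D + A2 - D' by rewrite -h addrAC subrr add0r.
by rewrite mulrBr mulrDr => ?; lra.
Qed.

(** Adding [W] to [S] removes the part of [W] in [Omega] from the symmetric difference and adds the
    part outside [Omega]. The identity [ED] records this with disjoint unions on both sides, so that
    areas are only added. The perimeter of the filled set enters through the upper bound [Q] on its
    fluxes. *)
Let fill_energy (c : R * R) (t Q : R) : 0 <= t ->
  (forall f g, test_field f g -> flux (S `|` euclid_ball c t) f g <= Q) ->
  P + lambda * area ((euclid_ball c t `\` S) `&` Omega) <=
  Q + lambda * area ((euclid_ball c t `\` S) `\` Omega).
Proof.
move=> t0 HQ; have ft := finite_area_euclid_ball c t0.
have mU : measurable (S `|` euclid_ball c t : set T) := measurableU _ _ mS ft.1.
have pU := perimeter_le mU HQ.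
have mW : measurable (euclid_ball c t `\` S : set T) := measurableD ft.1 mS.
have fW := finite_areaS mW (@subDsetl _ _ _) ft.
have f1 := finite_areaS (measurableI _ _ mW mO) (@subIsetl _ _ _) fW.
have f2 := finite_areaS (measurableD mW mO) (@subDsetl _ _ _) fW.
have mD' := msym mU.
set W := euclid_ball c t `\` S in mW fW f1 f2 *.
have ED : ((S `|` euclid_ball c t) `+` Omega) `|` (W `&` Omega) =
    (S `+` Omega) `|` (W `\` Omega).
  apply/seteqP; split => x; rewrite /setY /W/=;
    have := pselect (S x); have := pselect (Omega x);
    have := pselect (euclid_ball c t x); tauto.
have DW1 : ((S `|` euclid_ball c t) `+` Omega) `&` (W `&` Omega) = set0.
  by apply/seteqP; split => x //; rewrite /setY /W/=; tauto.
have DW2 : (S `+` Omega) `&` (W `\` Omega) = set0.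
  by apply/seteqP; split => x //; rewrite /setY /W/=; tauto.
have fD' : finite_area ((S `|` euclid_ball c t) `+` Omega).
  split=> //; apply: (@le_lt_trans _ _ (mu ((S `+` Omega) `|` (W `\` Omega)))).
    apply: le_measure; rewrite ?inE//; first exact: measurableU fD.1 f2.1.
    by rewrite -ED; exact: subsetUl.
  rewrite (measureU mu fD.1 f2.1 DW2) lte_add_pinfty//; [exact: fD.2|exact: f2.2].
have eA : area ((S `|` euclid_ball c t) `+` Omega) + area (W `&` Omega) =
    area (S `+` Omega) + area (W `\` Omega).
  by rewrite -(area_setU fD' f1 DW1) ED (area_setU fD f2 DW2).
apply: (fill_arith eA).
have := minS.2 _ mU; rewrite /energy (area_fin fD) (area_fin fD') => h.
rewrite -lee_fin !EFinD !EFinM /P (fineK perimeter_finite).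
by apply: le_trans h _; rewrite leeD2r.
Qed.

Let split_area (c : R * R) (t : R) : 0 <= t ->
  area (euclid_ball c t `\` S) = area ((euclid_ball c t `\` S) `&` Omega) +
    area ((euclid_ball c t `\` S) `\` Omega).
Proof.
move=> t0; have ft := finite_area_euclid_ball c t0.
have mW : measurable (euclid_ball c t `\` S : set T) := measurableD ft.1 mS.
have fW := finite_areaS mW (@subDsetl _ _ _) ft.
have f1 := finite_areaS (measurableI _ _ mW mO) (@subIsetl _ _ _) fW.
have f2 := finite_areaS (measurableD mW mO) (@subDsetl _ _ _) fW.
rewrite -(area_setU f1 f2) ?setUIDK//.
by apply/seteqP; split => x //= [[_ ?] [_ ?]].
Qed.

Let area_ball_le (c : R * R) (s t : R) : 0 <= s -> s <= t ->
  area (euclid_ball c s `\` S) <= area (euclid_ball c t `\` S).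
Proof.
move=> s0 st; have t0 := le_trans s0 st.
have ft := finite_area_euclid_ball c t0; have fs := finite_area_euclid_ball c s0.
apply: area_le.
- exact: measurableD fs.1 mS.
- by apply: setSD; exact: euclid_ballS.
- exact: (finite_areaS (measurableD ft.1 mS) (@subDsetl _ _ _) ft).
Qed.

Let large_arith (a t V A1 A2 d : R) : 0 < a -> a <= t -> 0 <= V -> V = A1 + A2 ->
  P + lambda * A1 <= P + 2 / t * V + lambda * A2 -> A2 <= d ->
  (lambda - 2 / a) * V <= 2 * lambda * d.
Proof.
move=> a0 at_ V0 VE h A2d; have l0' := l0.
have ta : 2 / t * V <= 2 / a * V.
  rewrite ler_wpM2r// ler_pM2l// lef_pV2// posrE//.
  exact: lt_le_trans at_.
have h2 : lambda * A2 <= lambda * d by rewrite ler_pM2l.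
have e1 : lambda * V = lambda * A1 + lambda * A2 by rewrite VE mulrDr.
rewrite mulrBl; move: h ta h2 e1; rewrite -(mulrA 2 lambda).
move: (2 / a * V) (2 / t * V) (lambda * V) (lambda * A1) (lambda * A2) (lambda * d).
by move=> *; lra.
Qed.

(* Beyond the critical radius 2 / lambda the comparison is linear, so no
   isoperimetric inequality is needed to see that the ball is almost filled. *)
Lemma almost_fill (c : R * R) (a b d : R) : 0 < a -> a < b ->
  area (euclid_ball c b `\` Omega) <= d ->
  2 < lambda * a ->
  (lambda - 2 / a) * area (euclid_ball c a `\` S) <= 2 * lambda * d.
Proof.
move=> a0 ab bd la.
(* The curvature estimate does not involve [kappa] or [q], so [kappa = 1] and the mean slope itself
   will do. *)
set A := fun r => area (euclid_ball c r `\` S) + 1 * area (euclid_ball c r).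
have slope : A b - A a <= (b - a) * ((A b - A a) / (b - a)).
  by rewrite mulrCA divff ?mulr1// subr_eq0 gt_eqF.
have [t [at_ tb Hcurv _]] := @fill_ball_estimates R S c P a b 1
  ((A b - A a) / (b - a)) mS a0 ab ltr01 flux_le_P slope.
have t0 : 0 <= t by exact: le_trans (ltW a0) at_.
have b0 : 0 <= b by exact: le_trans tb.
have ft := finite_area_euclid_ball c t0; have fb := finite_area_euclid_ball c b0.
have mW : measurable (euclid_ball c t `\` S : set T) := measurableD ft.1 mS.
have A2d : area ((euclid_ball c t `\` S) `\` Omega) <= d.
  apply: le_trans bd; apply: area_le.
  - exact: measurableD mW mO.
  - by move=> x [[xt _] xO]; split => //; apply: euclid_ballS xt.
  - exact: (finite_areaS (measurableD fb.1 mO) (@subDsetl _ _ _) fb).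
have h := fill_energy t0 Hcurv.
have h2 := large_arith a0 at_ (area_ge0 _) (split_area c t0) h A2d.
apply: le_trans h2; apply: ler_wpM2l.
  by rewrite subr_ge0 ler_pdivrMr// ltW.
exact: area_ball_le (ltW a0) at_.
Qed.

(** [lambda * h <= 2] bounds the area term [lambda * W] by [2 * (Vb / h)], the same form as the
    cutoff error [16 * (Vb / h)]; hence 18. *)
Let decay_arith (A1 A2 W Vb h L : R) : 0 < h -> 0 <= A1 -> 0 <= Vb -> W <= Vb ->
  W = A1 + A2 -> lambda * h <= 2 ->
  P + lambda * A1 <= P + 8 * (2 * Vb / h) - L + lambda * A2 -> L <= 18 * (Vb / h).
Proof.
move=> h0 A10 Vb0 WV WE lh H; have l0' := l0.
have lW : lambda * W <= 2 * (Vb / h).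
  apply: (@le_trans _ _ (lambda * Vb)); first by rewrite ler_pM2l.
  rewrite mulrCA mulrC ler_wpM2l// ler_pdivlMr//.
have lA1 : 0 <= lambda * A1 by rewrite mulr_ge0// ltW.
have e1 : lambda * W = lambda * A1 + lambda * A2 by rewrite WE mulrDr.
move: H lW e1 lA1; rewrite -(mulrA 2).
move: (Vb / h) (lambda * W) (lambda * A1) (lambda * A2) => z u v w *; lra.
Qed.

(** The weight [Vb / Ab] makes both summands equal to [Vb] at the outer radius, so the mean slope is
    at most [2 * Vb / h]. *)
Let kappa_arith (Va Vb Aa Ab h : R) : 0 < h -> 0 <= Va -> 0 <= Aa -> 0 < Vb -> 0 < Ab ->
  (Vb + Vb / Ab * Ab) - (Va + Vb / Ab * Aa) <= h * (2 * Vb / h).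
Proof.
move=> h0 Va0 Aa0 Vb0 Ab0; rewrite divfK ?gt_eqF// mulrCA divff ?gt_eqF// mulr1.
have : 0 <= Vb / Ab * Aa by rewrite mulr_ge0// divr_ge0// ltW.
move: (Vb / Ab * Aa) => z; lra.
Qed.

Lemma area_decay (c : R * R) (a b : R) : 0 < a -> a < b -> lambda * (b - a) <= 2 ->
  area (euclid_ball c a `\` S) <=
    32 * (18 * (area (euclid_ball c b `\` S) / (b - a))) ^+ 2.
Proof.
move=> a0 ab lab; have b0 := lt_trans a0 ab.
have fb := finite_area_euclid_ball c (ltW b0).
have mWb : measurable (euclid_ball c b `\` S : set T) := measurableD fb.1 mS.
(* The weight [kappa = Vb / Ab] has to be positive, so a vanishing area is treated apart. *)
have [Vb0|Vb0] := eqVneq (area (euclid_ball c b `\` S)) 0.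
  apply: (@le_trans _ _ 0); last by rewrite mulr_ge0// sqr_ge0.
  by rewrite -Vb0; exact: area_ball_le (ltW a0) (ltW ab).
have {}Vb0 : 0 < area (euclid_ball c b `\` S) by rewrite lt_def Vb0 area_ge0.
have Ab0 : 0 < area (euclid_ball c b).
  by apply: lt_le_trans Vb0 _; exact: (area_le mWb (@subDsetl _ _ _) fb).
have h0 : 0 < b - a by rewrite subr_gt0.
have slope := kappa_arith h0 (area_ge0 (euclid_ball c a `\` S))
  (area_ge0 (euclid_ball c a)) Vb0 Ab0.
have k0 := divr_gt0 Vb0 Ab0.
have [t [at_ tb _ Hflux]] := @fill_ball_estimates R S c P a b _ _ mS a0 ab k0
  flux_le_P slope.
have t0 := lt_le_trans a0 at_.
have ft := finite_area_euclid_ball c (ltW t0).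
have mW : measurable (euclid_ball c t `\` S : set T) := measurableD ft.1 mS.
apply: le_trans (area_ball_le c (ltW a0) at_) _.
apply: (isoperimetric mW t0 (@subDsetl _ _ _)) => f g tfg.
(* One test field for [B_t] minus [S] is frozen and its flux is subtracted from the bound for the
   filled set; minimality is then applied for this field alone. *)
have HQ f' g' : test_field f' g' -> flux (S `|` euclid_ball c t) f' g' <=
    P + 8 * (2 * area (euclid_ball c b `\` S) / (b - a)) -
    flux (euclid_ball c t `\` S) f g.
  by move=> tfg'; rewrite lerBrDr; exact: Hflux.
apply: (decay_arith h0 (area_ge0 _) (ltW Vb0) _ (split_area c (ltW t0)) lab
  (fill_energy (ltW t0) HQ)).
exact: area_ball_le (ltW t0) tb.
Qed.

End minimizer.

(* De Giorgi iteration on the radii r + H / 2 ^ k. *)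
Lemma quadratic_decay (R : realType) (V : R -> R) (r H C v : R) :
  0 < H -> 0 <= C -> 0 <= v ->
  (forall s, r <= s -> V r <= V s) -> (forall s, r <= s -> 0 <= V s) ->
  (forall a b, r <= a -> a < b -> b <= r + H -> V a <= C * (V b / (b - a)) ^+ 2) ->
  V (r + H) <= v -> 64 * C * v <= H ^+ 2 -> V r <= 0.
Proof.
move=> H0 C0 v0 mono V0 step Vv Cv.
pose x (k : nat) : R := 2^-1 ^+ k.
have x0 k : 0 < x k by rewrite exprn_gt0.
have x1 k : x k <= 1 by rewrite exprn_ile1// invf_le1// ler1n.
have xS k : x k.+1 = x k / 2 by rewrite /x exprSr.
(* Fourth powers survive the quadratic step: squaring [x k ^+ 4 / x k] gives [x k ^+ 6], with a
   factor [x k ^+ 2 <= 1] to spare. Halving [x k] costs [2 ^ 4 = 16], and [64 * C * v <= H ^+ 2]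
   says precisely [4 * C * v / H ^+ 2 <= 1 / 16]. *)
have key k : V (r + H * x k) <= v * x k ^+ 4.
  elim: k => [|k IHk].
    by rewrite /x expr0 !mulr1 expr1n mulr1.
  have Hx : 0 < H * x k.+1 by rewrite mulr_gt0.
  have dE : r + H * x k - (r + H * x k.+1) = H * x k / 2.
    by rewrite xS; field.
  have d0 : 0 < H * x k / 2 by rewrite divr_gt0// mulr_gt0.
  have Hxk : r <= r + H * x k by rewrite lerDl ltW// mulr_gt0.
  apply: (le_trans (step (r + H * x k.+1) (r + H * x k) _ _ _)).
  - by rewrite lerDl ltW.
  - by rewrite -subr_gt0 dE.
  - by rewrite lerD2l ger_pMr.
  rewrite dE.
  have q : V (r + H * x k) / (H * x k / 2) <= v * x k ^+ 4 / (H * x k / 2).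
    by rewrite ler_pM2r// invr_gt0.
  have q0 : 0 <= V (r + H * x k) / (H * x k / 2).
    by rewrite divr_ge0 ?(ltW d0)//; exact: V0.
  have q2 : (V (r + H * x k) / (H * x k / 2)) ^+ 2 <=
      (v * x k ^+ 4 / (H * x k / 2)) ^+ 2.
    by rewrite ler_sqr// nnegrE// (le_trans q0 q).
  apply: le_trans (ler_wpM2l C0 q2) _.
  have H2 : 0 < H ^+ 2 by rewrite exprn_gt0.
  have -> : C * (v * x k ^+ 4 / (H * x k / 2)) ^+ 2 =
      4 * C * v / H ^+ 2 * x k ^+ 2 * (v * x k ^+ 4).
    by field; rewrite !gt_eqF.
  rewrite xS; have -> : v * (x k / 2) ^+ 4 = 16^-1 * (v * x k ^+ 4) by field.
  apply: ler_wpM2r; first by rewrite mulr_ge0// exprn_ge0// ltW.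
  have h1 : 4 * C * v / H ^+ 2 <= 16^-1.
    by rewrite ler_pdivrMr//; move: Cv; lra.
  have h2 : x k ^+ 2 <= 1 by rewrite exprn_ile1// ltW.
  rewrite -[leRHS]mulr1; apply: ler_pM => //.
    by rewrite divr_ge0 ?(ltW H2)// !mulr_ge0.
  by rewrite exprn_ge0// ltW.
apply/ler_addgt0Pr => e e0; rewrite add0r.
have [k ke] : exists k, v * x k ^+ 4 <= e.
  pose k := Num.truncn (v / e); exists k.+1.
  have ve : v / e < k.+1%:R by exact: truncnS_gt.
  have k2 : k.+1%:R <= (2 : R) ^+ k.+1.
    by rewrite -natrX ler_nat; apply: ltnW; exact: ltn_expl.
  have vx : v * x k.+1 <= e.
    rewrite /x exprVn ler_pdivrMr ?exprn_gt0// mulrC -ler_pdivrMr//.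
    exact: le_trans (ltW ve) k2.
  apply: le_trans vx; apply: ler_wpM2l => //.
  by rewrite exprS ler_piMr ?(ltW (x0 _))// exprn_ile1// ltW.
apply: le_trans ke; apply: le_trans (key k); apply: mono.
by rewrite lerDl ltW// mulr_gt0.
Qed.

Theorem theorem2 (R : realType) (lambda R0 rhat eps : R)
    (lambda_gt0 : 0 < lambda) (R0E : R0 = 2 / lambda)
    (rhat_bounds : R0 < rhat < Num.sqrt 7 / 2 * R0)
    (eps_bounds : 0 < eps < 1 - (Num.sqrt 2)^-1) :
  exists2 delta : R, 0 < delta &
    forall (Omega Sigma : set (R * R)) (c : R * R),
      bounded_set Omega -> lebesgue_measurable2 Omega ->
      is_minimizer lambda Omega Sigma ->
      (lebesgue_measure2 R (euclid_ball c rhat `\` Omega) < delta%:E)%E ->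
      lebesgue_measure2 R (euclid_ball c ((1 - eps) * R0) `\` Sigma) = 0%E.
Proof.
move: rhat_bounds eps_bounds => /andP[R0rhat _] /andP[eps0 eps1].
have R00 : 0 < R0 by rewrite R0E divr_gt0.
have eps_lt1 : eps < 1.
  by apply: lt_le_trans eps1 _; rewrite gerBl invr_ge0 sqrtr_ge0.
(* Strictly above [R0], so that [lambda - 2 / a] is positive, and strictly below [rhat], which
   leaves room for choosing the filled radius. *)
pose a := (R0 + rhat) / 2.
have R0a : R0 < a by rewrite /a; lra.
have arhat : a < rhat by rewrite /a; lra.
have a0 : 0 < a by exact: lt_trans R0a.
have la : 2 < lambda * a by rewrite mulrC -ltr_pdivrMr// -R0E.
have gap : 0 < lambda - 2 / a by rewrite subr_gt0 ltr_pdivrMr.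
(* The width of the layer between the target radius and [R0] in which the iteration runs. *)
pose H := eps * R0; have H0 : 0 < H by rewrite mulr_gt0.
pose C : R := 32 * 18 ^+ 2.
have C0 : 0 < C by rewrite mulr_gt0// exprn_gt0.
(* The largest starting area that [quadratic_decay] admits, with [C] the constant of
   [area_decay]. *)
pose v := H ^+ 2 / (64 * C).
have v0 : 0 < v by rewrite divr_gt0 ?exprn_gt0// mulr_gt0.
(* With this [delta] the bound [2 * lambda * delta] of [almost_fill] equals [v * (lambda - 2 / a)].
   As [lambda] is [2 / R0], it depends on [R0], [rhat] and [eps] alone. *)
exists (v * (lambda - 2 / a) / (2 * lambda)).
  by apply: divr_gt0; apply: mulr_gt0.
move=> Omega Sigma c bO mO minS Bd.
set r := (1 - eps) * R0.
have r0 : 0 < r by rewrite mulr_gt0// subr_gt0.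
have rH : r + H = R0 by rewrite /r /H; ring.
have mS := minS.1.
have fball s := @finite_area_euclid_ball R c s.
have rhat0 : 0 < rhat by exact: lt_trans arhat.
have fBO : finite_area (euclid_ball c rhat `\` Omega).
  exact: (finite_areaS (measurableD (fball _ (ltW rhat0)).1 mO) (@subDsetl _ _ _)
    (fball _ (ltW rhat0))).
have fBS s : 0 <= s -> finite_area (euclid_ball c s `\` Sigma).
  move=> s0; exact: (finite_areaS (measurableD (fball _ s0).1 mS) (@subDsetl _ _ _)
    (fball _ s0)).
pose V s := area (euclid_ball c s `\` Sigma).
have V_le s s' : 0 <= s -> s <= s' -> V s <= V s'.
  move=> s0 ss; apply: area_le.
  - exact: (fBS _ s0).1.
  - by apply: setSD; exact: euclid_ballS.
  - exact: fBS (le_trans s0 ss).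
have Bd' : area (euclid_ball c rhat `\` Omega) <= v * (lambda - 2 / a) / (2 * lambda).
  by rewrite -lee_fin -(area_fin fBO) ltW.
have Va : V a <= v.
  have := almost_fill lambda_gt0 bO mO minS a0 arhat Bd' la.
  rewrite mulrC [X in _ <= X]mulrC divfK ?gt_eqF ?mulr_gt0//.
  by rewrite ler_pM2r.
have Vr0 : V r <= 0.
  apply: (@quadratic_decay _ V r H C v) => //.
  - exact: ltW.
  - exact: ltW.
  - by move=> s rs; apply: V_le => //; exact: ltW.
  - by move=> s _; exact: area_ge0.
  - move=> a' b' ra ab' bR.
    have a'0 : 0 < a' by exact: lt_le_trans ra.
    rewrite /C -mulrA -exprMn; apply: (area_decay lambda_gt0 bO mO minS) => //.
    (* All radii of the iteration lie between 0 and [R0], so the width condition of [area_decay]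
       follows from [lambda * R0 = 2]. *)
    apply: (@le_trans _ _ (lambda * R0)).
      rewrite ler_pM2l//; move: bR; rewrite rH; lra.
    by rewrite R0E mulrCA divff ?mulr1// gt_eqF.
  - rewrite rH; apply: le_trans Va; apply: V_le; exact: ltW.
  - by rewrite /v mulrCA divff ?mulr1// gt_eqF// mulr_gt0.
have fr := fBS r (ltW r0).
rewrite (area_fin fr); congr (_%:E); apply/eqP.
by rewrite eq_le Vr0 area_ge0.
Qed.
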